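(* If $G$ is a finite, simple, undirected, connected outerplanar graph, then $\zeta(G) \le 2$, where $\zeta(G)$ is the localization number of $G$.
   Context: Localization game: let $G$ be a finite, simple, undirected, connected graph and $m$ a positive integer. One player controls $m$ cops, the other controls an invisible robber. The robber first chooses a starting vertex $r_1$. In round $t=1,2,\dots$, the cops choose vertices $u_1,\dots,u_m$ of $G$ (arbitrarily; they are not restricted to moving to neighboring vertices, and the choice may depend on all earlier probes and their results) and learn the distance vector $(d_G(u_1,r_t),\dots,d_G(u_m,r_t))$; then the robber either stays or moves to a neighbor, so $r_{t+1}=r_t$ or $r_{t+1}$ is adjacent to $r_t$. The cops capture the robber in round $t$ if, after the probe of round $t$, the robber's current vertex $r_t$ is uniquely determined by the information the cops have received, i.e. all robber trajectories $r'_1,\dots,r'_t$ (consecutive vertices equal or adjacent) consistent with all the distance vectors received so far satisfy $r'_t=r_t$. The cops have a winning strategy if they have a strategy that captures the robber after finitely many rounds against every possible robber trajectory (equivalently, even a robber who knows the cops' entire strategy in advance). The robber wins if he is never captured. The localization number $\zeta(G)$ is the least positive integer $m$ for which $m$ cops have a winning strategy on $G$. *)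

(* Defs.v *)
From mathcomp Require Import all_boot all_order all_algebra.
From mathcomp Require Import all_classical all_reals all_analysis.
Import numFieldNormedType.Exports.

Set Implicit Arguments.
Unset Strict Implicit.
Unset Printing Implicit Defensive.

Record sgraph := SGraph {
  vertex :> finType;
  adj : rel vertex;
  adj_sym : symmetric adj;
  adj_irrefl : irreflexive adj;
  vertex_gt0 : 0 < #|vertex|
}.

Definition graph_connected (G : sgraph) : Prop :=
  forall x y : G, connect (@adj G) x y.

Definition has_walk (G : sgraph) (x y : G) (n : nat) : bool :=
  [exists p : n.-tuple G, path (@adj G) x p && (last x p == y)].

(* Least length of a walk from x to y. A shortest walk has fewer than #|G|
   edges; the value is #|G| when y is not reachable from x. *)
Definition gdist (G : sgraph) (x y : G) : nat :=
  find (has_walk x y) (iota 0 #|G|).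

Lemma gdist_eq0 (G : sgraph) (x y : G) : (gdist x y == 0) = (x == y).
Proof.
rewrite /gdist; case: #|G| (vertex_gt0 G) => // n _ /=.
have -> : has_walk x y 0 = (x == y).
  apply/existsP/idP => [[p]|/eqP ->]; first by rewrite (tuple0 p).
  by exists [tuple] => /=; rewrite eqxx.
by case: (x == y).
Qed.

Lemma has_walk_gdist (G : sgraph) (x y : G) :
  connect (@adj G) x y -> has_walk x y (gdist x y).
Proof.
move=> /connectP[p0 p0P ->]; case/shortenP: p0P => p pP up _ {p0}.
have hp : has (has_walk x (last x p)) (iota 0 #|G|).
  apply/hasP; exists (size p).
    rewrite mem_iota add0n /= -[(size p).+1]/(size (x :: p)).
    by rewrite -(card_uniqP up) max_card.
  by apply/existsP; exists (in_tuple p); rewrite pP eqxx.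
have := nth_find 0 hp; rewrite nth_iota ?add0n //.
by rewrite -[X in _ < X](size_iota 0) -has_find.
Qed.

Lemma gdist_min (G : sgraph) (x y : G) (n : nat) :
  has_walk x y n -> gdist x y <= n.
Proof.
move=> w; case: (ltnP n #|G|) => [nG|Gn].
  rewrite leqNgt; apply/negP => lt.
  by have := before_find 0 lt; rewrite nth_iota // add0n w.
by apply: leq_trans Gn; rewrite -[leqRHS](size_iota 0) find_size.
Qed.

(* Rounds are numbered from 0: [r t] is the robber's position at the probe of
   the (t+1)-st round. *)
Section LocalizationGame.
Variables (G : sgraph) (m : nat).

Definition trajectory (t : nat) (r : nat -> G) : Prop :=
  forall s, s < t -> r s.+1 = r s \/ adj (r s) (r s.+1).

Definition dist_vector (u : m.-tuple G) (x : G) : m.-tuple nat :=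
  [tuple gdist (tnth u i) x | i < m].

(* The next probe, as a function of the earlier probes with their results,
   oldest first. *)
Definition strategy : Type := seq (m.-tuple G * m.-tuple nat) -> m.-tuple G.

Fixpoint history (S : strategy) (r : nat -> G) (t : nat) :
    seq (m.-tuple G * m.-tuple nat) :=
  if t is s.+1 then
    let h := history S r s in rcons h (S h, dist_vector (S h) (r s))
  else [::].

Definition probe (S : strategy) (r : nat -> G) (t : nat) : m.-tuple G :=
  S (history S r t).

Definition captured (S : strategy) (r : nat -> G) (t : nat) : Prop :=
  forall r' : nat -> G, trajectory t r' ->
    (forall s, s <= t ->
       dist_vector (probe S r s) (r' s) = dist_vector (probe S r s) (r s)) ->
    r' t = r t.

Definition winning (S : strategy) : Prop :=
  forall r : nat -> G, (forall t, trajectory t r) -> exists t, captured S r t.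

Definition cops_win : Prop := exists S : strategy, winning S.

End LocalizationGame.

Lemma cops_win_card (G : sgraph) :
  exists m, (0 < m) && `[< cops_win G m >].
Proof.
exists #|G|; rewrite vertex_gt0; apply/asboolP.
exists (fun=> [tuple enum_val i | i < #|G|]) => r _; exists 0 => r' _ /(_ 0).
move=> /(_ isT)/(congr1 (fun v => tnth v (enum_rank (r 0)))).
rewrite !tnth_mktuple enum_rankK => e.
by apply/esym/eqP; rewrite -gdist_eq0 e gdist_eq0.
Qed.

Definition localization_number (G : sgraph) : nat := ex_minn (cops_win_card G).

Local Open Scope classical_set_scope.
Local Open Scope ring_scope.

Section PlaneDrawing.
Variables (R : realType) (G : sgraph).
Variables (pos : G -> R * R) (arc : G -> G -> R -> R * R).

(* [arc x y], restricted to [0, 1], parametrizes the edge xy from x to y; it is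
   irrelevant when x and y are not adjacent. *)
Record plane_drawing : Prop := PlaneDrawing {
  pos_inj : injective pos;
  arc_continuous : forall x y, adj x y ->
    {within `[0, 1], continuous (arc x y)};
  arc_inj : forall x y, adj x y -> {in `[0, 1] &, injective (arc x y)};
  arc0 : forall x y, adj x y -> arc x y 0 = pos x;
  arc1 : forall x y, adj x y -> arc x y 1 = pos y;
  arc_rev : forall x y, adj x y ->
    {in `[0, 1], forall t, arc y x t = arc x y (1 - t)};
  arc_vertex : forall x y v, adj x y ->
    {in `[0, 1], forall t, arc x y t = pos v -> v = x \/ v = y};
  arc_disjoint : forall x y z w, adj x y -> adj z w ->
    ~ (x = z /\ y = w) -> ~ (x = w /\ y = z) ->
    {in `[0, 1] &, forall s t, arc x y s = arc z w t ->
      exists v, arc x y s = pos v}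
}.

Definition drawing_set : set (R * R) :=
  [set p | (exists v, p = pos v) \/
           (exists x y, adj x y /\ (arc x y @` `[0, 1]) p)].

Definition outer_face : set (R * R) :=
  [set p | ~ drawing_set p /\
           ~ bounded_set (connected_component (~` drawing_set) p)].

(* Vertices lie in [drawing_set], hence not in [outer_face], so being in its
   closure is being on its boundary. *)
Definition vertices_on_outer_face : Prop :=
  forall v, closure outer_face (pos v).

End PlaneDrawing.

Definition outerplanar (R : realType) (G : sgraph) : Prop :=
  exists (pos : G -> R * R) (arc : G -> G -> R -> R * R),
    plane_drawing pos arc /\ vertices_on_outer_face pos arc.

(* Main.v *)
Require Import Defs.
From mathcomp Require Import all_boot all_order all_algebra.
From mathcomp Require Import all_classical all_reals all_analysis.
From mathcomp Require Import ring lra zify.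
From Stdlib Require Import Btauto.
Import Order.TTheory GRing.Theory Num.Theory numFieldNormedType.Exports.

Set Implicit Arguments.
Unset Strict Implicit.
Unset Printing Implicit Defensive.

(** The drawing yields a linear order of the vertices in which no two edges
cross, and with such an order two cops can sweep the graph.

All vertices lie on the boundary of the outer face, so a point far away can be
joined to each vertex by a path that touches only edges at this vertex. If the
graph contained three internally disjoint paths between two vertices, each with
an inner vertex, or a subdivision of the complete graph on four vertices, then
these paths and those from the far point would draw K_{3,3} or K_5 in the plane,
with disjoint curves for edges without a common end. After replacing arcs by
polygonal paths, [K33_nonplanar] and [K5_nonplanar] exclude this by a parity
count in place of the Jordan curve theorem: for two disjoint paths, the number
of vertical rays from the ends of either path that cross the other path an odd
number of times is determined modulo 2 by the left-to-right order of the four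
ends ([poly_exchange]). Summed over all pairs of independent edges, every ray
is counted twice, but the contributions of the order add up to an odd number.

Consequently, in a set of vertices that has no separating vertex, a longest
cycle misses no vertex, since an ear between consecutive vertices would lengthen
it and any other ear would give three paths as above; and two chords of the
cycle do not cross. Gluing the resulting circular orders at separating vertices
gives the order of the whole graph ([noncrossing_order]).

In the game, one cop always probes the first vertex [r] of the order, so the
distance of the robber from [r], called his level, is known. The rail to a
vertex [p] is the rightmost geodesic from [r] to [p]. The cops keep the robber
on the right of this rail, and advance [p] through the order. If the second cop
probes [p], a robber on the rail is caught, because no geodesic passes to the
right of the rail ([right_anc_rail]). A robber who is not caught can leave the
right side of the next rail only from a single vertex [x] of that rail, and only
towards a neighbour of [x] on the old rail, on the level of [x] or one below. If
there is such a neighbour, probing it catches the robber, or confines him to the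
right of the next rail, or shows that he has gone one level up
([strip_step]). As levels are bounded, the sweep advances until the robber is
caught. *)

Lemma addb_xorb a b : a (+) b = xorb a b. Proof. by case: a; case: b. Qed.

Lemma parity_trans A B C D : A = B -> xorb (xorb A B) (xorb C D) = false -> C = D.
Proof. by move=> ->; case: B C D => -[] []. Qed.

Lemma adjC (G : sgraph) (x y : G) : adj x y = adj y x.
Proof. exact: adj_sym. Qed.

(** * Parity of ray crossings for disjoint segments *)

Section PlaneParity.
Variable R : realType.
Local Open Scope ring_scope.
Implicit Types (p q r s v m : R * R).

(** Ordering points by abscissa, then by ordinate, amounts to ordering them by
abscissa after an infinitesimal rotation which puts no two points on a common
vertical line. This avoids any assumption of general position. *)
Definition lex p q := (p.1 < q.1) || (p.1 == q.1) && (p.2 < q.2).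

Definition area p q v := (q.1 - p.1) * (v.2 - p.2) - (q.2 - p.2) * (v.1 - p.1).

Definition on_segment p q m := exists2 t : R, 0 <= t <= 1 &
  m = (p.1 + t * (q.1 - p.1), p.2 + t * (q.2 - p.2)).

Definition below v p q := if lex p q then area p q v < 0 else area q p v < 0.

(** The upward ray from [v], rotated infinitesimally as for [lex], meets the
segment from [p] to [q]. *)
Definition cover v p q := (lex p v (+) lex q v) && below v p q.

Definition seg_disjoint p q r s :=
  forall m, on_segment p q m -> on_segment r s m -> False.

Lemma lex_neq p q : p <> q -> lex q p = ~~ lex p q.
Proof.
case: p q => [a b] [c d]; rewrite /lex /= => ne.
case: (ltgtP a c) => //= ac; case: (ltgtP b d) => //= bd.
by case: ne; rewrite ac bd.
Qed.

Lemma lexP p q : reflect (p.1 < q.1 \/ p.1 = q.1 /\ p.2 < q.2) (lex p q).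
Proof.
apply: (iffP orP) => -[h|h]; [by left| |by left|].
  by case/andP: h => /eqP h ?; right.
by right; case: h => -> ->; rewrite eqxx.
Qed.

Lemma lex_trans p q r : lex p q -> lex q r -> lex p r.
Proof. move=> /lexP h /lexP k; apply/lexP; lra. Qed.

Lemma on_segment_sym p q m : on_segment p q m -> on_segment q p m.
Proof.
case=> t t01 ->; exists (1 - t); first lra.
by congr pair; ring.
Qed.

Lemma on_segmentl p q : on_segment p q p.
Proof. by exists 0; [lra|case: p => a b /=; congr pair; ring]. Qed.

Lemma on_segmentr p q : on_segment p q q.
Proof. exact/on_segment_sym/on_segmentl. Qed.

Lemma area_eq0_on_segment p q m : lex p m -> lex m q -> area p q m = 0 ->
  on_segment p q m.
Proof.
case: p q m => [p1 p2] [q1 q2] [m1 m2] /lexP /= pm /lexP /= mq; rewrite /area /= => a0.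
have [e|ne] := eqVneq p1 q1.
  have e1 : m1 = p1 by lra.
  exists ((m2 - p2) / (q2 - p2)) => /=.
    by apply/andP; split; [apply: divr_ge0|rewrite ler_pdivrMr]; lra.
  by rewrite e1 e; congr pair; field; lra.
have lt : p1 < q1 by move/eqP: ne; lra.
exists ((m1 - p1) / (q1 - p1)) => /=.
  by apply/andP; split; [apply: divr_ge0|rewrite ler_pdivrMr]; lra.
congr pair; first by field; lra.
apply: (mulIf (_ : q1 - p1 != 0)); first by apply/eqP; lra.
transitivity (p2 * (q1 - p1) + (m1 - p1) * (q2 - p2)); first by lra.
by field; lra.
Qed.

Lemma lex_convex p r s (t : R) : 0 <= t <= 1 -> lex p r -> lex p s ->
  lex p (r.1 + t * (s.1 - r.1), r.2 + t * (s.2 - r.2)).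
Proof.
move=> /andP[t0 t1] /lexP pr /lexP ps; apply/lexP => /=.
have [e|t0'] := eqVneq t 0; first by rewrite e !mul0r !addr0.
have [e|t1'] := eqVneq t 1; first by rewrite e !mul1r; lra.
have lt0 : 0 < t by rewrite lt_neqAle eq_sym t0'.
have lt1 : t < 1 by rewrite lt_neqAle t1'.
case: pr ps => [pr|[e pr]] [ps|[e' ps]]; [left; nra|left; nra|left; nra|].
by right; split; nra.
Qed.

Lemma lex_convexr p r s (t : R) : 0 <= t <= 1 -> lex r p -> lex s p ->
  lex (r.1 + t * (s.1 - r.1), r.2 + t * (s.2 - r.2)) p.
Proof.
move=> /andP[t0 t1] /lexP pr /lexP ps; apply/lexP => /=.
have [e|t0'] := eqVneq t 0; first by rewrite e !mul0r !addr0.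
have [e|t1'] := eqVneq t 1; first by rewrite e !mul1r; lra.
have lt0 : 0 < t by rewrite lt_neqAle eq_sym t0'.
have lt1 : t < 1 by rewrite lt_neqAle t1'.
case: pr ps => [pr|[e pr]] [ps|[e' ps]]; [left; nra|left; nra|left; nra|].
by right; split; nra.
Qed.

(** Otherwise [r s] would meet the line through [p] and [q] at a point that is
between [p] and [q] for [lex], hence on the segment. *)
Lemma nested_same_side p q r s : lex p r -> lex p s -> lex r q -> lex s q ->
  seg_disjoint p q r s -> ~ (area p q r < 0 /\ 0 <= area p q s).
Proof.
move=> pr ps rq sq dis [h1 h2].
pose t := area p q r / (area p q r - area p q s).
have d0 : area p q r - area p q s < 0 by lra.
have t01 : 0 <= t <= 1.
  apply/andP; split; first by rewrite /t -mulrNN -invrN; apply: divr_ge0; lra.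
  by rewrite /t ler_ndivrMr //; lra.
apply: (dis (r.1 + t * (s.1 - r.1), r.2 + t * (s.2 - r.2))); last by exists t.
apply: area_eq0_on_segment; [exact: lex_convex|exact: lex_convexr|].
transitivity (area p q r - t * (area p q r - area p q s)).
  by rewrite /area /=; ring.
by rewrite /t divfK ?subrr //; apply/eqP; lra.
Qed.

(** The height of one segment above the other is affine over the common part of
their shadows, which extends from [r] to [q]. As it has opposite signs at these
two ends, it vanishes in between. *)
Lemma overlap_crossing p q r s : lex p r -> lex r q -> lex q s ->
  area p q r * area r s q > 0 -> ~ seg_disjoint p q r s.
Proof.
move=> pr rq qs.
pose W := (q.1 - p.1) * (s.2 - r.2) - (q.2 - p.2) * (s.1 - r.1).
(* the affine height difference between r and q, cleared of denominators *)
have idt : W * (q.1 - r.1) =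
    - (s.1 - r.1) * area p q r - (q.1 - p.1) * area r s q.
  by rewrite /W /area; ring.
have [pr1 rq1 qs1] : [/\ p.1 <= r.1, r.1 <= q.1 & q.1 <= s.1].
  by move: pr rq qs => /lexP pr /lexP rq /lexP qs; split; lra.
move=> pos dis.
have ltrq : r.1 < q.1.
  rewrite lt_neqAle rq1 andbT; apply/eqP => e.
  have z : (s.1 - r.1) * area p q r + (q.1 - p.1) * area r s q = 0.
    by move: idt; rewrite e subrr mulr0; lra.
  have [sr|sr] : s.1 - r.1 = 0 \/ 0 < s.1 - r.1 by lra.
    have [qp|qp] : q.1 - p.1 = 0 \/ 0 < q.1 - p.1 by lra.
      have z1 : area p q r = 0 by rewrite /area qp (_ : r.1 - p.1 = 0) ?mul0r ?mulr0 ?subrr //; lra.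
      by rewrite z1 mul0r ltxx in pos.
    by move: z; rewrite sr mul0r add0r => /eqP; rewrite mulf_eq0 => /orP[/eqP|/eqP z]; [lra|rewrite z mulr0 ltxx in pos].
  move: (pos) => /lt0r_neq0; rewrite mulf_eq0 negb_or => /andP[/eqP n1 /eqP n2].
  have : (s.1 - r.1) * area p q r ^+ 2 + (q.1 - p.1) * (area p q r * area r s q) = 0.
    by transitivity (area p q r * ((s.1 - r.1) * area p q r + (q.1 - p.1) * area r s q)); [ring|rewrite z mulr0].
  have a2 : 0 < area p q r ^+ 2 by rewrite exprn_even_gt0 //=; apply/eqP.
  have : 0 < (s.1 - r.1) * area p q r ^+ 2 by rewrite mulr_gt0.
  have : 0 <= (q.1 - p.1) * (area p q r * area r s q) by rewrite mulr_ge0 //; lra.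
  lra.
have W0 : W != 0.
  apply/eqP => w0; move: idt; rewrite w0 mul0r => z.
  have : (s.1 - r.1) * area p q r ^+ 2 + (q.1 - p.1) * (area p q r * area r s q) = 0.
    by transitivity (- area p q r * (- (s.1 - r.1) * area p q r - (q.1 - p.1) * area r s q)); [ring|rewrite -z mulr0].
  have a2 : 0 <= area p q r ^+ 2 by rewrite sqr_ge0.
  have : 0 <= (s.1 - r.1) * area p q r ^+ 2 by rewrite mulr_ge0 //; lra.
  have : 0 < (q.1 - p.1) * (area p q r * area r s q) by rewrite mulr_gt0 //; lra.
  lra.
(* the parameters of the intersection of the two lines on [r s] and [p q] *)
pose t := - area p q r / W; pose u := 1 + area r s q / W.
have tu : (q.1 - r.1) = (s.1 - r.1) * t + (q.1 - p.1) * (1 - u).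
  by rewrite /t /u; apply: (mulfI W0); rewrite idt; field.
have t0u : 0 <= t * (1 - u).
  have -> : t * (1 - u) = (area p q r * area r s q) * (W ^-1) ^+ 2 by rewrite /t /u; field.
  by rewrite mulr_ge0 ?sqr_ge0 ?ltW.
have sr0 : 0 < s.1 - r.1 by lra.
have qp0 : 0 < q.1 - p.1 by lra.
have aux (a b x y : R) : 0 < a -> 0 < b -> 0 <= x * y -> 0 < a * x + b * y -> 0 <= x.
  move=> a0 b0 xy sum; rewrite leNgt; apply/negP => xn.
  have yn : y <= 0 by rewrite leNgt; apply/negP => yp; move: xy; rewrite leNgt nmulr_rlt0 // yp.
  have : a * x < 0 by rewrite pmulr_rlt0.
  have : b * y <= 0 by rewrite pmulr_rle0.
  lra.
have sum0 : 0 < (s.1 - r.1) * t + (q.1 - p.1) * (1 - u) by rewrite -tu; lra.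
have t0 : 0 <= t by apply: (aux _ _ _ _ sr0 qp0 t0u sum0).
have u1 : 0 <= 1 - u.
  by apply: (aux _ _ _ _ qp0 sr0 _ _); [rewrite mulrC; exact: t0u|rewrite addrC; exact: sum0].
have t1 : t <= 1.
  rewrite -(ler_pM2l sr0) mulr1.
  have : 0 <= (q.1 - p.1) * (1 - u) by rewrite mulr_ge0 // ltW.
  lra.
have u0 : 0 <= u.
  suff : 1 - u <= 1 by lra.
  rewrite -(ler_pM2l qp0) mulr1.
  have : 0 <= (s.1 - r.1) * t by rewrite mulr_ge0 // ltW.
  lra.
apply: (dis (r.1 + t * (s.1 - r.1), r.2 + t * (s.2 - r.2))); last by exists t => //; lra.
exists u; first lra.
by congr pair; rewrite /t /u /area; move: W0; rewrite /W => W0; field.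
Qed.

Lemma area_neq0 p q r s : lex p r -> lex r q -> seg_disjoint p q r s ->
  area p q r <> 0.
Proof.
move=> pr rq dis /(area_eq0_on_segment pr rq) h.
exact: dis h (on_segmentl _ _).
Qed.

Lemma seg_disjointC p q r s : seg_disjoint p q r s -> seg_disjoint r s p q.
Proof. by move=> d m h1 h2; apply: (d m). Qed.

Lemma seg_disjointl p q r s : seg_disjoint p q r s -> seg_disjoint q p r s.
Proof. by move=> d m /on_segment_sym; apply: d. Qed.

Lemma coverC v p q : cover v p q = cover v q p.
Proof.
rewrite /cover addbC; have [->//|/eqP ne] := eqVneq p q.
by rewrite /below (lex_neq ne); case: (lex p q).
Qed.

Lemma cover_exchange_sorted p q r s : lex p q -> lex r s -> lex p r ->
  seg_disjoint p q r s ->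
  cover r p q (+) cover s p q (+) cover p r s (+) cover q r s =
  lex p r (+) lex p s (+) lex q r (+) lex q s.
Proof.
move=> pq rs pr dis.
have nlex a b : lex a b -> lex b a = false.
  by move=> /lexP h; apply/negbTE/negP => /lexP; lra.
have ps := lex_trans pr rs.
have ne_qr : q <> r.
  move=> e; apply: (dis q); first exact: on_segmentr.
  by rewrite e; exact: on_segmentl.
have ne_qs : q <> s.
  move=> e; apply: (dis q); first exact: on_segmentr.
  by rewrite e; exact: on_segmentr.
rewrite /cover /below pq rs pr ps !(nlex _ _ pr) !(nlex _ _ ps) /=.
have [qr|qr] := boolP (lex q r).
  have qs := lex_trans qr rs.
  by rewrite qs (nlex _ _ qr) (nlex _ _ qs).
move: qr; rewrite -(lex_neq ne_qr) => rq; rewrite rq /=.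
have nr := area_neq0 pr rq dis.
have [qs|] := boolP (lex q s); last first.
  rewrite -(lex_neq ne_qs) => sq; rewrite sq /=.
  have := nested_same_side pr ps rq sq dis.
  have := nested_same_side ps pr sq rq (fun m a b => dis m a (on_segment_sym b)).
  by case: (ltP (area p q r) 0) => h1; case: (ltP (area p q s) 0) => h2 //= k1 k2; [case: k2|case: k1].
rewrite (nlex _ _ qs) /=.
have nq : area r s q <> 0.
  exact: (area_neq0 rq qs (seg_disjointC (seg_disjointl dis))).
have ov : ~ 0 < area p q r * area r s q by move=> /(overlap_crossing pr rq qs).
have [h1|h1] := ltP (area p q r) 0; have [h2|h2] := ltP (area r s q) 0 => //=.
  by case: ov; rewrite nmulr_rgt0.
by case: ov; rewrite mulr_gt0 // lt_neqAle ?h1 ?h2 andbT eq_sym; apply/eqP.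
Qed.

(** Over the common part of their shadows, one of the segments stays above the
other. Either end of the common part is an end of one of the segments, and its
ray meets the other segment exactly when it belongs to the lower one. So an odd
number of rays meet a segment if and only if the two ends of the common part
come from different segments; that is, if the ends of the two segments
interlace. *)
Lemma cover_exchange p q r s : seg_disjoint p q r s ->
  cover r p q (+) cover s p q (+) cover p r s (+) cover q r s =
  lex p r (+) lex p s (+) lex q r (+) lex q s.
Proof.
have cov0 v a : cover v a a = false by rewrite /cover addbb.
have [<-|/eqP npq] := eqVneq p q; first 
  by move=> _; rewrite !cov0 !addb_xorb; btauto.
have [<-|/eqP nrs] := eqVneq r s; first 
  by move=> _; rewrite !cov0 !addb_xorb; btauto.
wlog pq : p q npq / lex p q => [wl dis|].
  have [/wl|] := boolP (lex p q); first exact.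
  rewrite -(lex_neq npq) => /wl-/(_ (nesym npq))-/(_ (seg_disjointl dis)).
  by rewrite !(coverC _ q p); move/parity_trans; apply; rewrite !addb_xorb; btauto.
wlog rs : r s nrs / lex r s => [wl dis|].
  have [/wl|] := boolP (lex r s); first exact.
  rewrite -(lex_neq nrs) => /wl-/(_ (nesym nrs)).
  move/(_ (seg_disjointC (seg_disjointl (seg_disjointC dis)))).
  by rewrite !(coverC _ s r); move/parity_trans; apply; rewrite !addb_xorb; btauto.
move=> dis.
have [pr|pr] : lex p r \/ lex p r = false by case: (lex p r); [left|right].
  exact: cover_exchange_sorted.
have ne x y : on_segment p q x -> on_segment r s y -> x <> y.
  by move=> h1 h2 e; apply: (dis x) => //; rewrite e.
have pl := on_segmentl p q; have pr_ := on_segmentr p q.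
have rl := on_segmentl r s; have rr := on_segmentr r s.
have rp : lex r p by rewrite (lex_neq (ne _ _ pl rl)) pr.
have := cover_exchange_sorted rs pq rp (seg_disjointC dis).
rewrite (lex_neq (ne _ _ pl rl)) (lex_neq (ne _ _ pl rr)) (lex_neq (ne _ _ pr_ rl)) (lex_neq (ne _ _ pr_ rr)).
by move/parity_trans; apply; rewrite !addb_xorb; btauto.
Qed.

End PlaneParity.

(** * Parity for polygonal paths, and two nonplanar graphs *)

Section PolyParity.
Variable R : realType.
Implicit Types (p q v m : R * R) (s t : seq (R * R)) (O : R * R -> Prop).

Fixpoint poly_cover v p s : bool :=
  if s is q :: s' then cover v p q (+) poly_cover v q s' else false.

Fixpoint poly_in O p s : Prop :=
  if s is q :: s' then (forall m, on_segment p q m -> O m) /\ poly_in O q s'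
  else True.

Lemma poly_in_cat O p s t :
  poly_in O p s -> poly_in O (last p s) t -> poly_in O p (s ++ t).
Proof.
elim: s p => //= q s IH p [h1 h2] h3; split => //; exact: IH.
Qed.

Lemma sub_poly_in O O' p s : (forall m, O m -> O' m) -> poly_in O p s -> poly_in O' p s.
Proof.
move=> sub; elim: s p => //= q s IH p [h1 h2]; split; last exact: IH.
by move=> m /h1/sub.
Qed.

Lemma segment_poly_exchange O O' p p' q t :
  (forall m, O m -> O' m -> False) ->
  (forall m, on_segment p p' m -> O m) -> poly_in O' q t ->
  cover q p p' (+) cover (last q t) p p' (+) poly_cover p q t (+) poly_cover p' q t
  = lex p q (+) lex p (last q t) (+) lex p' q (+) lex p' (last q t).
Proof.
move=> dis hO; elim: t q => [|q' t IH] q /=.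
  by move=> _; rewrite !addb_xorb; btauto.
move=> [hq /IH {}IH]; have := @cover_exchange _ p p' q q'.
move/(_ (fun m h1 h2 => dis m (hO m h1) (hq m h2))) => e.
apply: (parity_trans (f_equal2 addb IH e)).
by rewrite !addb_xorb; btauto.
Qed.

(** Intermediate points of the paths contribute twice to both sides. *)
Lemma poly_exchange O O' p s q t :
  (forall m, O m -> O' m -> False) -> poly_in O p s -> poly_in O' q t ->
  poly_cover q p s (+) poly_cover (last q t) p s (+)
    poly_cover p q t (+) poly_cover (last p s) q t
  = lex p q (+) lex p (last q t) (+) lex (last p s) q (+) lex (last p s) (last q t).
Proof.
move=> dis + hq; elim: s p => [|p' s IH] p /=.
  by move=> _; rewrite !addb_xorb; btauto.
move=> [hp /IH {}IH]; have e := segment_poly_exchange dis hp hq.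
apply: (parity_trans (f_equal2 addb IH e)).
by rewrite !addb_xorb; btauto.
Qed.

Definition poly_disjoint p s q t := exists O O',
  [/\ forall m, O m -> O' m -> False, poly_in O p s & poly_in O' q t].

End PolyParity.

Section NonPlanar.
Variable R : realType.

(** Paths with a common end may cross. In the sum of [poly_exchange] over all
pairs of independent edges, each ray count occurs twice, since a vertex off a
given edge lies on two edges independent of it. The order terms cancel, except
that each pair [i, i'] and each pair [j, j'] leaves
[lex (b j) (b j') (+) lex (b j') (b j)], which is 1: nine times in all. *)
Theorem K33_nonplanar (a b : 'I_3 -> R * R) (s : 'I_3 -> 'I_3 -> seq (R * R)) :
  injective b -> (forall i j, last (a i) (s i j) = b j) ->
  (forall i j i' j', i != i' -> j != j' ->
     poly_disjoint (a i) (s i j) (a i') (s i' j')) -> False.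
Proof.
move=> b_inj ends dis.
have E i j i' j' : i != i' -> j != j' ->
  xorb (xorb (xorb (xorb (poly_cover (a i') (a i) (s i j)) (poly_cover (b j') (a i) (s i j)))
  (xorb (poly_cover (a i) (a i') (s i' j')) (poly_cover (b j) (a i') (s i' j'))))
  (xorb (lex (a i) (a i')) (lex (a i) (b j')))) (xorb (lex (b j) (a i')) (lex (b j) (b j'))) = false.
  move=> ii jj; have [U [V [d h1 h2]]] := dis _ _ _ _ ii jj.
  have := poly_exchange d h1 h2; rewrite !ends.
  move: (poly_cover _ _ _) (poly_cover _ _ _) (poly_cover _ _ _) (poly_cover _ _ _).
  by move: (lex _ _) (lex _ _) (lex _ _) (lex _ _); do 8!case.
pose o0 : 'I_3 := inord 0; pose o1 : 'I_3 := inord 1; pose o2 : 'I_3 := inord 2.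
have n01 : o0 != o1 by rewrite -val_eqE /= !inordK.
have n02 : o0 != o2 by rewrite -val_eqE /= !inordK.
have n12 : o1 != o2 by rewrite -val_eqE /= !inordK.
have [n10 n20 n21] : [/\ o1 != o0, o2 != o0 & o2 != o1] by split; rewrite eq_sym.
have L i j : i != j -> lex (b j) (b i) = negb (lex (b i) (b j)).
  by move=> ij; apply: lex_neq => /b_inj /eqP; apply/negP.
move: (L _ _ n01) (L _ _ n02) (L _ _ n12) => L01 L02 L12.
(* add up the eighteen identities *)
have X2 x y : x = false -> y = false -> xorb x y = false by move=> -> ->.
have := (X2 _ _ (X2 _ _ (X2 _ _ (X2 _ _ (X2 _ _ (X2 _ _ (X2 _ _ (X2 _ _ (X2 _ _ (X2 _ _ (X2 _ _ (X2 _ _ (X2 _ _ (X2 _ _ (X2 _ _ (X2 _ _ (X2 _ _ (E o0 o0 o1 o1 n01 n01)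
  (E o0 o0 o1 o2 n01 n02))
  (E o0 o1 o1 o0 n01 n10))
  (E o0 o1 o1 o2 n01 n12))
  (E o0 o2 o1 o0 n01 n20))
  (E o0 o2 o1 o1 n01 n21))
  (E o0 o0 o2 o1 n02 n01))
  (E o0 o0 o2 o2 n02 n02))
  (E o0 o1 o2 o0 n02 n10))
  (E o0 o1 o2 o2 n02 n12))
  (E o0 o2 o2 o0 n02 n20))
  (E o0 o2 o2 o1 n02 n21))
  (E o1 o0 o2 o1 n12 n01))
  (E o1 o0 o2 o2 n12 n02))
  (E o1 o1 o2 o0 n12 n10))
  (E o1 o1 o2 o2 n12 n12))
  (E o1 o2 o2 o0 n12 n20))
  (E o1 o2 o2 o1 n12 n21)).
rewrite L01 L02 L12 => h; apply: (Bool.diff_true_false); rewrite -h; btauto.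
Qed.

(** The same sum over the fifteen pairs of independent edges. Its order terms
count, modulo 2, the pairs of edges that cross when the vertices are put on a
circle in the given order: five. *)
Theorem K5_nonplanar (a : 'I_5 -> R * R) (s : 'I_5 -> 'I_5 -> seq (R * R)) :
  injective a -> (forall i j : 'I_5, i < j -> last (a i) (s i j) = a j) ->
  (forall i j k l : 'I_5, i < j -> k < l -> i < k -> j != k -> j != l ->
     poly_disjoint (a i) (s i j) (a k) (s k l)) -> False.
Proof.
move=> a_inj ends dis.
have E (i j k l : 'I_5) : i < j -> k < l -> i < k -> j != k -> j != l ->
  xorb (xorb (xorb (xorb (poly_cover (a k) (a i) (s i j)) (poly_cover (a l) (a i) (s i j)))
  (xorb (poly_cover (a i) (a k) (s k l)) (poly_cover (a j) (a k) (s k l))))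
  (xorb (lex (a i) (a k)) (lex (a i) (a l)))) 
  (xorb (if j < k then lex (a j) (a k) else negb (lex (a k) (a j)))
        (if j < l then lex (a j) (a l) else negb (lex (a l) (a j)))) = false.
  move=> ij kl ik jk jl; have [U [V [d h1 h2]]] := dis _ _ _ _ ij kl ik jk jl.
  have := poly_exchange d h1 h2; rewrite !ends //.
  have L x y : x != y -> lex (a x) (a y) = negb (lex (a y) (a x)).
    by rewrite eq_sym => xy; apply: lex_neq => /a_inj /eqP; apply/negP.
  rewrite -(L _ _ jk) -(L _ _ jl) !if_same.
  move: (poly_cover _ _ _) (poly_cover _ _ _) (poly_cover _ _ _) (poly_cover _ _ _).
  by move: (lex _ _) (lex _ _) (lex _ _) (lex _ _); do 8!case.
pose o0 : 'I_5 := Ordinal (isT : 0 < 5); pose o1 : 'I_5 := Ordinal (isT : 1 < 5).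
pose o2 : 'I_5 := Ordinal (isT : 2 < 5); pose o3 : 'I_5 := Ordinal (isT : 3 < 5).
pose o4 : 'I_5 := Ordinal (isT : 4 < 5).
(* add up the fifteen identities *)
have X2 x y : x = false -> y = false -> xorb x y = false by move=> -> ->.
have := (X2 _ _ (X2 _ _ (X2 _ _ (X2 _ _ (X2 _ _ (X2 _ _ (X2 _ _ (X2 _ _ (X2 _ _ (X2 _ _ (X2 _ _ (X2 _ _ (X2 _ _ (X2 _ _ (E o0 o1 o2 o3 isT isT isT isT isT)
  (E o0 o1 o2 o4 isT isT isT isT isT))
  (E o0 o1 o3 o4 isT isT isT isT isT))
  (E o0 o2 o1 o3 isT isT isT isT isT))
  (E o0 o2 o1 o4 isT isT isT isT isT))
  (E o0 o2 o3 o4 isT isT isT isT isT))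
  (E o0 o3 o1 o2 isT isT isT isT isT))
  (E o0 o3 o1 o4 isT isT isT isT isT))
  (E o0 o3 o2 o4 isT isT isT isT isT))
  (E o0 o4 o1 o2 isT isT isT isT isT))
  (E o0 o4 o1 o3 isT isT isT isT isT))
  (E o0 o4 o2 o3 isT isT isT isT isT))
  (E o1 o2 o3 o4 isT isT isT isT isT))
  (E o1 o3 o2 o4 isT isT isT isT isT))
  (E o1 o4 o2 o3 isT isT isT isT isT)).
rewrite /= => h; apply: (Bool.diff_true_false); rewrite -h; btauto.
Qed.

End NonPlanar.

(** * Polygonal paths in the plane *)

Section PolyPaths.
Variable R : realType.
Local Open Scope ring_scope.
Local Open Scope classical_set_scope.
Implicit Types (p q v m x y : R * R) (s t : seq (R * R)) (O C : set (R * R)).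

Lemma ball_pairP x y (e : R) :
  ball x e y <-> `|x.1 - y.1| < e /\ `|x.2 - y.2| < e.
Proof. by []. Qed.

Lemma segment_ball x p q m (e : R) :
  ball x e p -> ball x e q -> on_segment p q m -> ball x e m.
Proof.
move=> /ball_pairP[p1 p2] /ball_pairP[q1 q2] [t /andP[t0 t1] ->].
move: p1 p2 q1 q2; rewrite !ltr_norml => /andP[? ?] /andP[? ?] /andP[? ?] /andP[? ?].
have [->|tn0] := eqVneq t 0.
  by apply/ball_pairP; rewrite !mul0r !addr0 /= !ltr_norml; split; apply/andP.
have tp : 0 < t by rewrite lt_neqAle eq_sym tn0.
by apply/ball_pairP; rewrite /= !ltr_norml; split; apply/andP; split; nra.
Qed.

(** The points that can be reached from [x] form a subset of [C] that is open
and closed in [C], since balls are convex. This applies both to an open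
connected set and to an arc with a tube around it. *)
Lemma connected_poly_path C O : connected C -> (forall x, C x -> nbhs x O) ->
  forall x y, C x -> C y -> exists s, last x s = y /\ poly_in O x s.
Proof.
move=> cC nO x y Cx Cy.
pose B := [set z | C z /\ exists s, last x s = z /\ poly_in O x s].
have step y' p q : B p -> C q -> C y' ->
    (exists e : R, ball y' e `<=` O /\ ball y' e p /\ ball y' e q) -> B q.
  move=> [Cp [s [ls ps]]] Cq _ [e [bO [bp bq]]]; split=> //.
  exists (rcons s q); rewrite last_rcons; split=> //.
  rewrite -cats1; apply: poly_in_cat => //=; rewrite ls; split=> // m hm.
  exact/bO/(segment_ball bp bq hm).
pose hull (P : set (R * R)) :=
  [set p | exists y', exists e : R, [/\ P y', ball y' e `<=` O & ball y' e p]].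
have hull_open P : open (hull P).
  rewrite openE => p [y' [e [Py yO yp]]].
  have := open_nbhs_nbhs (conj (ball_open y' e) yp).
  by apply: filterS => q yq; exists y', e.
have cover z : C z -> exists2 e : R, 0 < e & ball z e `<=` O.
  by move=> /nO /nbhs_ballP.
have Bx : B x by split=> //; exists [::].
suff BC : B = C by have := Cy; rewrite -BC => -[].
apply: cC; first by exists x.
- exists (hull B); first exact: hull_open.
  apply/seteqP; split=> [p Bp|p [Cp [y' [e [By' yO yp]]]]].
    by split; [case: Bp|have [e e0 pO] := cover p (proj1 Bp); exists p, e; split=> //; exact: ballxx].
  have [e' e0 _] := cover p Cp.
  apply: (step y' y' p By' Cp (proj1 By')); exists e; split=> //; split=> //.
  by apply: ballxx; case/ball_pairP: yp => /(le_lt_trans (normr_ge0 _)).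
- exists (~` hull (C `\` B)); first exact/open_closedC/hull_open.
  apply/seteqP; split=> [p Bp|p [Cp np]].
    split; first by case: Bp.
    move=> [y' [e [[Cy' nBy'] yO yp]]]; apply: nBy'.
    apply: (step y' p y' Bp Cy' Cy'); exists e; split=> //; split=> //.
    by apply: ballxx; case/ball_pairP: yp => /(le_lt_trans (normr_ge0 _)).
  apply: contrapT => nB; apply: np.
  by have [e e0 pO] := cover p Cp; exists p, e; split=> //; exact: ballxx.
Qed.

Lemma segment_closed p q : closed (on_segment p q).
Proof.
apply: compact_closed; first exact: norm_hausdorff.
have -> : on_segment p q = (fun t : R => (p.1 + t * (q.1 - p.1), p.2 + t * (q.2 - p.2))) @` `[0, 1].
  apply/seteqP; split=> m [t] /=; first by move=> t01 ->; exists t; rewrite //= in_itv.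
  by rewrite in_itv /= => t01 <-; exists t.
have aff (a c t : R) : (a + u * c) @[u --> t] --> a + t * c.
  by apply: cvgD; [exact: cvg_cst|apply: cvgM; [exact: cvg_id|exact: cvg_cst]].
apply: continuous_compact; last exact: segment_compact.
apply: continuous_subspaceT => t; rewrite /continuous_at.
exact: (cvg_pair (aff p.1 (q.1 - p.1) t) (aff p.2 (q.2 - p.2) t)).
Qed.

Fixpoint track p s : set (R * R) :=
  if s is q :: s' then on_segment p q `|` track q s' else set0.

Lemma track_closed p s : closed (track p s).
Proof.
elim: s p => [|q s IH] p /=; first exact: closed0.
by apply: closedU => //; exact: segment_closed.
Qed.

Lemma poly_in_track p s : poly_in (track p s) p s.
Proof.
elim: s p => //= q s IH p; split; first by move=> m; left.
by apply: sub_poly_in (IH q) => m; right.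
Qed.

Lemma track_sub O p s : poly_in O p s -> track p s `<=` O.
Proof.
elim: s p => [|q s IH] p /=; first by move=> _ m [].
by move=> [h1 h2] m [/h1|/(IH _ h2)].
Qed.

Lemma closed_compact_separated (A B : set (R * R)) :
  compact A -> closed B -> A `&` B = set0 ->
  \forall e \near 0^'+, forall a b, A a -> B b -> ~ ball a e b.
Proof.
move=> cA cB AB.
have := (compact_near_coveringP A).1 cA R 0^'+ (fun e a => forall b, B b -> ~ ball a e b) _.
move=> h; have {h} : \forall e \near 0^'+, A `<=` (fun a => forall b, B b -> ~ ball a e b).
  apply: h => a Aa.
  have nB : ~ B a by move=> Ba; have : (A `&` B) a by []; rewrite AB.
  have oB : open (~` B) by exact: closed_openC.
  have /nbhs_ballP[d /= d0 dB] := open_nbhs_nbhs (conj oB nB).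
  near=> a' e.
  have ed : e <= d / 2 by near: e; apply: nbhs_right_le; lra.
  have aa : ball a (d / 2) a' by near: a'; apply: nbhsx_ballx; lra.
  move=> b Bb bb.
  apply: (dB b) => //.
  have -> : d = d / 2 + d / 2 by lra.
  by apply: ball_triangle aa _; apply: le_ball bb.
by apply: filterS => e h a b Aa; apply: h.
Unshelve. all: by end_near.
Qed.

Lemma closed_exists (I : finType) (F : I -> set (R * R)) :
  (forall i, closed (F i)) -> closed [set p | exists i, F i p].
Proof.
move=> cF; have -> : [set p | exists i, F i p] = \bigcup_(i in [set: I]) F i.
  by apply/seteqP; split=> p [i]; [exists i|move=> _; exists i].
by apply: closed_bigcup => [|i _]; [exact: finite_finset|exact: cF].
Qed.

Lemma closed_if (P : bool) (A : set (R * R)) :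
  (P -> closed A) -> closed [set p | P /\ A p].
Proof.
case: P => h.
  by have -> : [set p | true /\ A p] = A; [apply/seteqP; split=> p // [] | exact: h].
have -> : [set p | false /\ A p] = set0 by apply/seteqP; split=> p // [].
exact: closed0.
Qed.

Lemma closed_point p : closed [set p].
Proof. exact: (accessible_closed_set1 (hausdorff_accessible (@norm_hausdorff _ _))). Qed.

End PolyPaths.

(** * From an outerplanar drawing to a polygonal drawing *)

Section PolygonalDrawing.
Variables (R : realType) (G : sgraph).

(** A drawing of the graph together with an apex [w] joined to all vertices, in
which the regions [E] and [Q] enclose the edges and the spokes. Only edges and
spokes without a common end are kept apart, which is stable under approximation
of the arcs: they are disjoint compact sets. *)
Record polygonal_drawing (pos : G -> R * R) (w : R * R) (q : G -> seq (R * R))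
    (e : G -> G -> seq (R * R)) (Q : G -> R * R -> Prop)
    (E : G -> G -> R * R -> Prop) : Prop := PolygonalDrawing {
  pd_inj : injective pos;
  pd_apex : forall v, w <> pos v;
  pd_spoke_last : forall v, last w (q v) = pos v;
  pd_spoke_in : forall v, poly_in (Q v) w (q v);
  pd_edge_last : forall x y, adj x y -> last (pos x) (e x y) = pos y;
  pd_edge_in : forall x y, adj x y -> poly_in (E x y) (pos x) (e x y);
  pd_edge_edge : forall x y z t m, adj x y -> adj z t ->
    x != z -> x != t -> y != z -> y != t -> E x y m -> E z t m -> False;
  pd_edge_spoke : forall x y v m, adj x y -> v != x -> v != y ->
    E x y m -> Q v m -> False
}.

Section FromDrawing.
Variables (pos : G -> R * R) (arc : G -> G -> R -> R * R).
Hypotheses (dr : plane_drawing pos arc) (outer : vertices_on_outer_face pos arc).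
Local Open Scope ring_scope.
Local Open Scope classical_set_scope.

Let arcset x y := arc x y @` `[0, 1].
Let D := drawing_set pos arc.

Lemma arc_compact x y : adj x y -> compact (arcset x y).
Proof.
move=> xy; apply: continuous_compact (arc_continuous dr xy) _.
exact: segment_compact.
Qed.

Lemma arc_connected x y : adj x y -> connected (arcset x y).
Proof.
move=> xy; apply: connected_continuous_connected (arc_continuous dr xy).
exact: segment_connected.
Qed.

Lemma arc_closed x y : adj x y -> closed (arcset x y).
Proof. by move=> /arc_compact; apply: compact_closed; exact: norm_hausdorff. Qed.

Lemma arc_ends x y : adj x y -> arcset x y (pos x) /\ arcset x y (pos y).
Proof.
move=> xy; split.
  by exists 0; [rewrite /= in_itv /= lexx ler01|exact: arc0].
by exists 1; [rewrite /= in_itv /= lexx ler01|exact: arc1].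
Qed.

Lemma drawing_closed : closed D.
Proof.
have -> : D = [set p | exists v, [set pos v] p] `|`
   [set p | exists xy : G * G, adj xy.1 xy.2 /\ arcset xy.1 xy.2 p].
  apply/seteqP; split=> p.
    by case=> [[v ->]|[x [y h]]]; [left; exists v|right; exists (x, y)].
  by case=> [[v ->]|[[x y] h]]; [left; exists v|right; exists x, y].
apply: closedU; first by apply: closed_exists => v; exact: closed_point.
by apply: closed_exists => -[x y]; apply: closed_if; exact: arc_closed.
Qed.

Lemma drawing_bounded :
  exists M : R, forall p, D p -> `|p.1| <= M /\ `|p.2| <= M.
Proof.
have [M hM] : exists M : R, forall xy : G * G, adj xy.1 xy.2 ->
    forall p, arcset xy.1 xy.2 p -> `|p| <= M.
  have : \forall M \near +oo, forall xy : G * G, adj xy.1 xy.2 ->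
    forall p, arcset xy.1 xy.2 p -> `|p| <= M.
    apply: filter_forall => -[x y] /=.
    have [xy|nxy] := boolP (adj x y); last exact: nearW.
    have [N [Nr hN]] := compact_bounded (arc_compact xy).
    by exists N; split=> // M NM _; exact: hN.
  by move=> /filter_ex.
have [M' hM'] : exists M : R, forall v, `|pos v| <= M.
  have : \forall M \near +oo, forall v, `|pos v| <= M.
    by apply: filter_forall => v; apply: nbhs_pinfty_ge; exact: num_real.
  by move=> /filter_ex.
exists (Num.max M M') => p Dp.
suff : `|p| <= Num.max M M' by rewrite prod_normE ge_max => /andP.
rewrite le_max; case: Dp => [[v ->]|[x [y [xy h]]]].
  by rewrite hM' orbT.
by rewrite (hM (x, y)).
Qed.

Let avoid v := [set p | exists u, u != v /\ [set pos u] p] `|`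
  [set p | exists xy : G * G, [&& adj xy.1 xy.2, v != xy.1 & v != xy.2] /\
     arcset xy.1 xy.2 p].

Lemma avoid_closed v : closed (avoid v).
Proof.
apply: closedU.
  by apply: closed_exists => u; apply: closed_if => _; exact: closed_point.
apply: closed_exists => -[x y]; apply: closed_if => /and3P[xy _ _].
exact: arc_closed.
Qed.

Lemma avoid_pos v : ~ avoid v (pos v).
Proof.
case=> [[u [/eqP ne /= /(pos_inj dr) e]]|[[x y] /= [/and3P[xy /eqP vx /eqP vy] [t t01 e]]]].
  exact: ne.
by have [] := arc_vertex dr xy t01 e.
Qed.

Lemma avoid_sub v : avoid v `<=` D.
Proof.
move=> p [[u [_ /= ->]]|[[x y] [/and3P[xy _ _] h]]]; first by left; exists u.
by right; exists x, y.
Qed.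

Lemma escape p (M : R) : ~ bounded_set (connected_component (~` D) p) ->
  exists2 q, connected_component (~` D) p q & M < `|q.1| \/ M < `|q.2|.
Proof.
move=> ub; apply: contrapT => no; apply: ub.
have : \forall N \near +oo, M <= N by apply: nbhs_pinfty_ge; exact: num_real.
apply: filterS => N MN q Cq; apply: le_trans MN.
rewrite leNgt; apply/negP; rewrite prod_normE lt_max => /orP h.
by apply: no; exists q.
Qed.

(** Out of a box that contains the drawing, two straight pieces lead from the
corner point to the component of the outer face that comes close to [v], and a
path inside this component then leads into a ball around [v] that meets only
edges at [v]. *)
Lemma access (M : R) : (forall p, D p -> `|p.1| <= M /\ `|p.2| <= M) ->
  forall v, exists s, last (M + 1, M + 1) s = pos v /\
    poly_in (~` avoid v) (M + 1, M + 1) s.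
Proof.
move=> hM v; have M0 : 0 <= M.
  by apply: le_trans (normr_ge0 (pos v).1) _; apply: (hM _ _).1; left; exists v.
have far m : M < `|m.1| \/ M < `|m.2| -> (~` avoid v) m.
  move=> h /avoid_sub /hM [h1 h2].
  by case: h => /lt_le_trans h; [have := h _ h1|have := h _ h2]; rewrite ltxx.
have oA : open (~` avoid v) by exact/closed_openC/avoid_closed.
have /nbhs_ballP[e /= e0 eA] := open_nbhs_nbhs (conj oA (@avoid_pos v)).
have [p [[nDp ub] pv]] := outer (nbhsx_ballx (pos v) _ e0).
have [q Cq qM] := escape M ub.
have [s [ls ps]] := connected_poly_path (@component_connected _ _ p)
  (fun x Cx => open_nbhs_nbhs (conj (closed_openC drawing_closed) (connected_component_sub Cx)))
  Cq (connected_component_refl nDp).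
pose c := if M < `|q.1| then (q.1, M + 1) else (M + 1, q.2).
have M1 : M < `|M + 1| by rewrite ger0_norm; lra.
exists ([:: c; q] ++ s ++ [:: pos v]); split; first by rewrite !last_cat.
apply: poly_in_cat => /=.
  split; [|split=> //].
    move=> m [t _ ->]; apply: far; rewrite /= /c; case: ifP => _ /=.
      by right; rewrite subrr mulr0 addr0.
    by left; rewrite subrr mulr0 addr0.
  move=> m [t _ ->]; apply: far; rewrite /= /c; case: ifP => h /=.
    by left; rewrite subrr mulr0 addr0.
  by case: qM => h'; [rewrite h' in h|right; rewrite subrr mulr0 addr0].
apply: poly_in_cat; first by apply: sub_poly_in ps => m nD /avoid_sub.
rewrite ls /=; split=> // m /(segment_ball pv) h; apply: eA; apply: h.
exact: ballxx.
Qed.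

Lemma arcs_disjoint x y z t : adj x y -> adj z t ->
  x != z -> x != t -> y != z -> y != t -> arcset x y `&` arcset z t = set0.
Proof.
move=> xy zt xz xt yz yt; apply/seteqP; split=> // m [[a a01 am] [b b01 bm]].
have e : arc x y a = arc z t b by rewrite am bm.
have [v ev] : exists v, arc x y a = pos v.
  apply: (arc_disjoint dr xy zt _ _ a01 b01 e) => -[e1 _].
    by rewrite e1 eqxx in xz.
  by rewrite e1 eqxx in xt.
have [ex|ex] := arc_vertex dr xy a01 ev;
have [ey|ey] := arc_vertex dr zt b01 (etrans (esym e) ev).
- by rewrite -ex ey eqxx in xz.
- by rewrite -ex ey eqxx in xt.
- by rewrite -ex ey eqxx in yz.
- by rewrite -ex ey eqxx in yt.
Qed.

(** Thin tubes around independent arcs are disjoint, and also disjoint from the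
spokes to other vertices. *)
Lemma exists_polygonal_drawing :
  exists w q e Q E, polygonal_drawing pos w q e Q E.
Proof.
have [M hM] := drawing_bounded.
pose w : R * R := (M + 1, M + 1).
have [q hq] := choice (access hM).
have sepA : \forall d \near 0^'+, forall xyzt : (G * G) * (G * G),
    [&& adj xyzt.1.1 xyzt.1.2, adj xyzt.2.1 xyzt.2.2 & [&& xyzt.1.1 != xyzt.2.1,
     xyzt.1.1 != xyzt.2.2, xyzt.1.2 != xyzt.2.1 & xyzt.1.2 != xyzt.2.2]] ->
    forall a b, arcset xyzt.1.1 xyzt.1.2 a -> arcset xyzt.2.1 xyzt.2.2 b ->
    ~ ball a d b.
  apply: filter_forall => -[[x y] [z t]] /=.
  case: (boolP [&& _, _ & _]) => [/and3P[xy zt /and4P[xz xt yz yt]]|_]; last exact: nearW.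
  have := closed_compact_separated (arc_compact xy) (arc_closed zt)
    (arcs_disjoint xy zt xz xt yz yt).
  by apply: filterS => d h _.
have sepQ : \forall d \near 0^'+, forall xyv : (G * G) * G,
    [&& adj xyv.1.1 xyv.1.2, xyv.2 != xyv.1.1 & xyv.2 != xyv.1.2] ->
    forall a b, arcset xyv.1.1 xyv.1.2 a -> track w (q xyv.2) b -> ~ ball a d b.
  apply: filter_forall => -[[x y] v] /=.
  case: (boolP [&& _, _ & _]) => [/and3P[xy vx vy]|_]; last exact: nearW.
  have : arcset x y `&` track w (q v) = set0.
    apply/seteqP; split=> // m [am /(track_sub (hq v).2)]; apply.
    by right; exists (x, y); split=> //; apply/and3P.
  move=> /(closed_compact_separated (arc_compact xy) (@track_closed _ _ _)).
  by apply: filterS => d h _.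
have [d [d0 dA dQ]] : exists d : R, [/\ 0 < d,
   forall xyzt : (G * G) * (G * G),
    [&& adj xyzt.1.1 xyzt.1.2, adj xyzt.2.1 xyzt.2.2 & [&& xyzt.1.1 != xyzt.2.1,
     xyzt.1.1 != xyzt.2.2, xyzt.1.2 != xyzt.2.1 & xyzt.1.2 != xyzt.2.2]] ->
    forall a b, arcset xyzt.1.1 xyzt.1.2 a -> arcset xyzt.2.1 xyzt.2.2 b ->
    ~ ball a d b &
   forall xyv : (G * G) * G,
    [&& adj xyv.1.1 xyv.1.2, xyv.2 != xyv.1.1 & xyv.2 != xyv.1.2] ->
    forall a b, arcset xyv.1.1 xyv.1.2 a -> track w (q xyv.2) b -> ~ ball a d b].
  apply: (@filter_ex _ (0 : R)^'+); near=> d; split; [|near: d..] => //.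
pose E x y m := exists2 a, arcset x y a & ball a (d / 2) m.
have hE xy : exists s, adj xy.1 xy.2 ->
    last (pos xy.1) s = pos xy.2 /\ poly_in (E xy.1 xy.2) (pos xy.1) s.
  case: xy => x y /=; have [xy|_] := boolP (adj x y); last by exists [::].
  have [a0 a1] := arc_ends xy.
  have nE z : arcset x y z -> nbhs z (E x y).
    move=> az; have /filterS : ball z (d / 2) `<=` E x y by move=> m; exists z.
    by apply; apply: nbhsx_ballx; lra.
  have [s hs] := connected_poly_path (arc_connected xy) nE a0 a1.
  by exists s.
have [e he] := choice hE.
exists w, q, (fun x y => e (x, y)), (fun v => track w (q v)), E; split.
- exact: (pos_inj dr).
- move=> v /(congr1 fst) /= wv.
  have [+ _] := hM (pos v) (or_introl (ex_intro _ v erefl)).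
  by rewrite -wv; have := ler_norm (M + 1); lra.
- by move=> v; case: (hq v).
- by move=> v; exact: poly_in_track.
- by move=> x y xy; case: (he (x, y) xy).
- by move=> x y xy; case: (he (x, y) xy).
- move=> x y z t m xy zt xz xt yz yt [a am ma] [b bm mb].
  have := dA ((x, y), (z, t)); rewrite /= xy zt xz xt yz yt => /(_ isT a b am bm).
  by apply; rewrite (_ : d = d / 2 + d / 2); [exact: ball_triangle ma (ball_sym mb)|lra].
- move=> x y v m xy vx vy [a am ma] mv.
  have := dQ ((x, y), v); rewrite /= xy vx vy => /(_ isT a m am mv); apply.
  by apply: le_ball ma; lra.
Unshelve. all: by end_near.
Qed.

End FromDrawing.
End PolygonalDrawing.

(** * Forbidden subdivisions *)

(** Absence of a subdivided K_{2,3}: disjointness is imposed on those pairs of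
paths that come from independent edges. *)
Definition theta_free (G : sgraph) : Prop :=
  forall (a b : G) (c : 'I_3 -> G) (A B : 'I_3 -> seq G),
  (forall i, path (@adj G) a (A i) /\ last a (A i) = c i) ->
  (forall i, path (@adj G) b (B i) /\ last b (B i) = c i) ->
  (forall i j, i != j -> ~~ has [in b :: B j] (a :: A i)) -> False.

(** Absence of a subdivided K_4, with [P i j] read from the lower index to the
higher one. *)
Definition K4_free (G : sgraph) : Prop :=
  forall (c : nat -> G) (P : nat -> nat -> seq G),
  (forall i j, i < j < 4 -> path (@adj G) (c i) (P i j) /\ last (c i) (P i j) = c j) ->
  (forall i j, i < j < 4 -> c i != c j) ->
  (forall i j k, i < j < 4 -> k < 4 -> k != i -> k != j -> c k \notin c i :: P i j) ->
  (forall i j k l, i < j < 4 -> i < k -> k < l < 4 -> j != k -> j != l ->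
     ~~ has [in c k :: P k l] (c i :: P i j)) -> False.

Section ForbiddenSubdivisions.
Variables (R : realType) (G : sgraph).
Variables (pos : G -> R * R) (w : R * R) (q : G -> seq (R * R)).
Variables (e : G -> G -> seq (R * R)) (Q : G -> R * R -> Prop).
Variables (E : G -> G -> R * R -> Prop).
Hypothesis pd : polygonal_drawing pos w q e Q E.

Fixpoint path_poly (x : G) (p : seq G) : seq (R * R) :=
  if p is y :: p' then e x y ++ path_poly y p' else [::].

Definition path_region (s : seq G) (m : R * R) : Prop :=
  exists x y, [/\ adj x y, x \in s, y \in s & E x y m].

Lemma path_poly_last x p :
  path (@adj G) x p -> last (pos x) (path_poly x p) = pos (last x p).
Proof.
elim: p x => //= y p IH x /andP[xy yp].
by rewrite last_cat (pd_edge_last pd xy) IH.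
Qed.

Lemma path_poly_in x p :
  path (@adj G) x p -> poly_in (path_region (x :: p)) (pos x) (path_poly x p).
Proof.
elim: p x => //= y p IH x /andP[xy yp]; apply: poly_in_cat.
  apply: sub_poly_in (pd_edge_in pd xy) => m xym.
  by exists x, y; split; rewrite // !inE eqxx ?orbT.
rewrite (pd_edge_last pd xy); apply: sub_poly_in (IH y yp) => m [z [t [zt zp tp h]]].
by exists z, t; split; rewrite // inE ?zp ?tp orbT.
Qed.

Lemma path_poly_disjoint x p y r : path (@adj G) x p -> path (@adj G) y r ->
  ~~ has [in y :: r] (x :: p) ->
  poly_disjoint (pos x) (path_poly x p) (pos y) (path_poly y r).
Proof.
move=> xp yr /hasPn dis.
exists (path_region (x :: p)), (path_region (y :: r)); split.
- move=> m [a [b [ab ap bp abm]]] [c [d [cd cr dr cdm]]].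
  have ne u v : u \in x :: p -> v \in y :: r -> u != v.
    by move=> up vr; apply: contraNneq (dis u up) => ->.
  by apply: (pd_edge_edge pd ab cd _ _ _ _ abm cdm); apply: ne.
- exact: path_poly_in.
- exact: path_poly_in.
Qed.

Lemma poly_disjointC (p p' : R * R) s s' :
  poly_disjoint p s p' s' -> poly_disjoint p' s' p s.
Proof. by move=> [U [V [d h h']]]; exists V, U; split=> // m h1 h2; apply: d h2 h1. Qed.

Lemma path_spoke_disjoint x p c : path (@adj G) x p -> c \notin x :: p ->
  poly_disjoint (pos x) (path_poly x p) w (q c).
Proof.
move=> xp cp; exists (path_region (x :: p)), (Q c); split.
- move=> m [a [b [ab ap bp abm]]] cm.
  apply: (pd_edge_spoke pd ab _ _ abm cm); first by apply: contraNneq cp => ->.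
  by apply: contraNneq cp => ->.
- exact: path_poly_in.
- exact: (pd_spoke_in pd).
Qed.

(** The apex, joined to the three vertices [c i], would complete a K_{3,3}. *)
Lemma polygonal_theta_free : theta_free G.
Proof.
move=> a b c A B hA hB dis.
have cA i : c i \in a :: A i by rewrite -(hA i).2 mem_last.
have cB i : c i \in b :: B i by rewrite -(hB i).2 mem_last.
have c_inj : injective c.
  move=> i j cij; apply/eqP/negPn/negP => ne.
  by have /hasPn/(_ _ (cA i)) := dis i j ne; rewrite cij /= cB.
have cAn i j : i != j -> c j \notin a :: A i.
  move=> ij; apply/negP => h; have /hasPn/(_ _ h) := dis i j ij.
  by rewrite /= cB.
have cBn i j : i != j -> c j \notin b :: B i.
  by rewrite eq_sym => ij; exact: (hasPn (dis j i ij) _ (cA j)).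
have disAB i j : i != j ->
  poly_disjoint (pos a) (path_poly a (A i)) (pos b) (path_poly b (B j)).
  by move=> ij; apply: path_poly_disjoint (hA i).1 (hB j).1 (dis i j ij).
have disA i j : i != j -> poly_disjoint (pos a) (path_poly a (A i)) w (q (c j)).
  by move=> ij; apply: path_spoke_disjoint (hA i).1 (cAn _ _ ij).
have disB i j : i != j -> poly_disjoint (pos b) (path_poly b (B i)) w (q (c j)).
  by move=> ij; apply: path_spoke_disjoint (hB i).1 (cBn _ _ ij).
pose start (i : 'I_3) : R * R := match val i with 0 => pos a | 1 => pos b | _ => w end.
pose line (i j : 'I_3) := match val i with
  0 => path_poly a (A j) | 1 => path_poly b (B j) | _ => q (c j) end.
apply: (@K33_nonplanar R start (pos \o c) line).
- exact: inj_comp (pd_inj pd) c_inj.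
- case=> [[|[|[|//]]] ? j]; rewrite /start /line /=.
  + by rewrite (path_poly_last (hA j).1) (hA j).2.
  + by rewrite (path_poly_last (hB j).1) (hB j).2.
  + exact: (pd_spoke_last pd).
- case=> [[|[|[|//]]] ?] j [[|[|[|//]]] ?] j' // _ jj; rewrite /start /line /=.
  + exact: disAB.
  + exact: disA.
  + by apply: poly_disjointC; apply: disAB; rewrite eq_sym.
  + exact: disB.
  + by apply: poly_disjointC; apply: disA; rewrite eq_sym.
  + by apply: poly_disjointC; apply: disB; rewrite eq_sym.
Qed.

(** The apex would complete a K_5. *)
Lemma polygonal_K4_free : K4_free G.
Proof.
move=> c P hP c_ne c_off dis.
pose pt (i : nat) : R * R := if i is k.+1 then pos (c k) else w.
pose line (i j : nat) := if i is k.+1 then path_poly (c k) (P k j.-1) else q (c j.-1).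
apply: (@K5_nonplanar R (fun i => pt (val i)) (fun i j => line (val i) (val j))).
- have pt_ne i j : i < j < 5 -> pt i <> pt j.
    case: i j => [|i] [|j] //= ij; first exact: (pd_apex pd).
    by move/(pd_inj pd)/eqP; apply/negP/c_ne.
  move=> i j e_ij; apply: val_inj; case: (ltngtP (val i) (val j)) => // ij.
    by case: (pt_ne (val i) (val j)); rewrite ?ij ?ltn_ord.
  by case: (pt_ne (val j) (val i)); rewrite ?ij ?ltn_ord.
- move=> [[|i] /= hi] [[|j] /= hj] //= ij; first exact: (pd_spoke_last pd).
  have [h1 h2] := hP i j (introT andP (conj ij hj)).
  by rewrite path_poly_last ?h2.
- move=> [[|i] /= hi] [[|j] /= hj] [[|k] /= hk] [[|l] /= hl] //= ij kl ik.
  + rewrite -!val_eqE /= !eqSS => jk jl.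
    have [h1 h2] := hP k l (introT andP (conj kl hl)).
    apply/poly_disjointC/path_spoke_disjoint; first exact: h1.
    by apply: (c_off k l j (introT andP (conj kl hl))).
  rewrite -!val_eqE /= !eqSS => jk jl.
  have [h1 h2] := hP i j (introT andP (conj ij hj)).
  have [h3 h4] := hP k l (introT andP (conj kl hl)).
  apply: path_poly_disjoint => //.
  by apply: (dis i j k l (introT andP (conj ij hj)) ik (introT andP (conj kl hl))).
Qed.

End ForbiddenSubdivisions.

(** * A linear order of the vertices without crossing edges *)

Section NoncrossingOrder.
Import mathcomp.boot.fintype mathcomp.boot.finset.
Variable G : sgraph.
Implicit Types (s p C : seq G) (S A B : {set G}) (a b c x y z : G).

Definition noncrossing s := forall a b c d,
  index a s < index b s -> index b s < index c s -> index c s < index d s ->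
  index d s < size s -> adj a c -> ~~ adj b d.

Lemma noncrossing_small s : size s <= 3 -> noncrossing s.
Proof. by move=> h a b c d; lia. Qed.

(** Whether two edges cross depends only on the circular order. *)
Lemma noncrossing_rot1 s : uniq s -> noncrossing s -> noncrossing (rot 1 s).
Proof.
case: s => [|x s] //; rewrite rot1_cons => /andP[xs us] nc a b c d ab bc cd.
rewrite size_rcons ltnS => ds.
have ind y : index y (rcons s x) < size s -> index y (x :: s) = (index y (rcons s x)).+1.
  rewrite -cats1 index_cat; case: ifP => ys; last by rewrite ltnNge leq_addr.
  by move=> _ /=; rewrite (negbTE (_ : x != y)) //; apply: contraNneq xs => ->.
have hc := leq_trans cd ds; have hb := ltn_trans bc hc; have ha := ltn_trans ab hb.
move: ds; rewrite leq_eqVlt => /orP[/eqP ds|ds].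
  have dx : d = x.
    move: ds; rewrite -cats1 index_cat; case: ifP => [|_ /=]; first by rewrite -index_mem => + e; rewrite e ltnn.
    by case: eqP => [->//|_] e; move: (leqnn (size s)); rewrite -{1}e addn1 ltnn.
  rewrite dx => ac; apply/negP; rewrite adjC => xb; move: ac.
  have := nc x a b c; rewrite (ind a) // (ind b) // (ind c) // [index x _]/= eqxx !ltnS => h.
  by apply/negP/h.
by move: (nc a b c d); rewrite !ind // !ltnS; apply.
Qed.

Lemma noncrossing_rot n s : uniq s -> noncrossing s -> noncrossing (rot n s).
Proof.
move=> us nc; have [ns|sn] := leqP n (size s); last by rewrite rot_oversize // ltnW.
elim: n ns => [_|n IH ns]; first by rewrite rot0.
by rewrite rotS //; apply: noncrossing_rot1; [rewrite rot_uniq|apply/IH/ltnW].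
Qed.

(** Two edges that cross are in the same piece, as the pieces meet in [x]
only. *)
Lemma noncrossing_glue x s1 s2 : uniq (x :: s1 ++ s2) ->
  (forall y z, y \in s1 -> z \in s2 -> ~~ adj y z) ->
  noncrossing (x :: s1) -> noncrossing (x :: s2) -> noncrossing (x :: s1 ++ s2).
Proof.
move=> /= /andP[]; rewrite mem_cat negb_or => /andP[xs1 xs2].
rewrite cat_uniq => /and3P[u1 /hasPn u12 u2] no_edge nc1 nc2 a b c d.
set s := x :: s1 ++ s2 => ab bc cd ds.
have pos y : index y s < size s ->
  [\/ y = x /\ index y s = 0,
      y \in s1 /\ index y s = (index y s1).+1 |
      y \in s2 /\ index y s = (size s1 + index y s2).+1].
  rewrite index_mem inE mem_cat => /or3P[/eqP->|y1|y2].
  - by constructor 1; rewrite /s /= eqxx.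
  - constructor 2; rewrite /s /= index_cat y1 (negbTE (_ : x != y)) //.
    by apply: contraNneq xs1 => ->.
  - constructor 3; rewrite /s /= index_cat (negbTE (u12 _ y2)) (negbTE (_ : x != y)) //.
    by apply: contraNneq xs2 => ->.
have hc := ltn_trans cd ds; have hb := ltn_trans bc hc; have ha := ltn_trans ab hb.
clearbody s.
have i1 y : y \in s1 -> index y (x :: s1) = (index y s1).+1.
  by move=> h /=; rewrite (negbTE (_ : x != y)) //; apply: contraNneq xs1 => ->.
have i2 y : y \in s2 -> index y (x :: s2) = (index y s2).+1.
  by move=> h /=; rewrite (negbTE (_ : x != y)) //; apply: contraNneq xs2 => ->.
have i0 t : index x (x :: t) = 0 by rewrite /= eqxx.
have lt1 y : y \in s1 -> index y s1 < size s1 by rewrite index_mem.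
have lt2 y : y \in s2 -> index y s2 < size s2 by rewrite index_mem.
have [[dm di]|[dm di]|[dm di]] := pos d ds; first by clear - cd di; lia.
- have dl := lt1 _ dm.
  have [[cm ci]|[cm ci]|[cm ci]] := pos c hc; last by clear - cd ci di dl; lia.
    by clear - bc ci; lia.
  have cl := lt1 _ cm.
  have [[bm bi]|[bm bi]|[bm bi]] := pos b hb; last by clear - bc bi ci cl; lia.
    by clear - ab bi; lia.
  have bl := lt1 _ bm.
  have [[am ai]|[am ai]|[am ai]] := pos a ha; last by clear - ab ai bi bl; lia.
    move: (nc1 a b c d); rewrite (i1 b) // (i1 c) // (i1 d) // am i0 [size _]/=.
    by apply; clear - bc cd bi ci di dl; lia.
  move: (nc1 a b c d); rewrite !i1 // [size _]/=.
  by apply; clear - ab bc cd ai bi ci di dl; lia.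
have [[bm bi]|[bm bi]|[bm bi]] := pos b hb; first by clear - ab bi; lia.
  by move=> _; exact: no_edge.
have [[cm ci]|[cm ci]|[cm ci]] := pos c hc.
- by clear - bc ci; lia.
- by have cl := lt1 _ cm; clear - bc bi ci cl; lia.
have dl := lt2 _ dm; have [[am ai]|[am ai]|[am ai]] := pos a ha.
- move: (nc2 a b c d); rewrite (i2 b) // (i2 c) // (i2 d) // am i0 [size _]/=.
  by apply; clear - bc cd bi ci di dl; lia.
- by move=> ac; have := no_edge _ _ am cm; rewrite ac.
move: (nc2 a b c d); rewrite !i2 // [size _]/=.
by apply; clear - ab bc cd ai bi ci di dl; lia.
Qed.

Definition ear a b p := path (@adj G) a (rcons p b).

Lemma cycle_extend a b s p : ucycle (@adj G) (a :: b :: s) -> ear a b p ->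
  uniq p -> ~~ has [in a :: b :: s] p -> ucycle (@adj G) (a :: p ++ b :: s).
Proof.
rewrite /ear /ucycle => /andP[/= /andP[ab bs] us] ep up dis.
rewrite /= rcons_cat /= -cat_rcons cat_path ep last_rcons bs /=.
have : uniq ((a :: b :: s) ++ p) by rewrite cat_uniq up dis !andbT.
rewrite (perm_uniq (_ : perm_eq _ (a :: p ++ b :: s))) //.
by rewrite /= perm_cons -cat_cons perm_catC.
Qed.

Hypothesis theta : theta_free G.

(** Otherwise the ear and the two arcs of the cycle form a theta graph. *)
Lemma ear_consecutive a b s1 s2 p : ucycle (@adj G) (a :: s1 ++ b :: s2) ->
  ear a b p -> uniq p -> ~~ has [in a :: s1 ++ b :: s2] p ->
  [\/ p = [::], s1 = [::] | s2 = [::]].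
Proof.
have [->|p_n] := eqVneq p [::]; first by constructor 1.
have [->|s1_n] := eqVneq s1 [::]; first by constructor 2.
have [->|s2_n] := eqVneq s2 [::]; first by constructor 3.
rewrite /ear rcons_path => /andP[cyc us] /andP[cp pb] up dis.
have [[cs1 ab] [cs2 ba]] : (path (@adj G) a s1 /\ adj (last a s1) b) /\
    (path (@adj G) b s2 /\ adj (last b s2) a).
  move: cyc; rewrite (_ : cycle _ _ = path (@adj G) a (rcons (s1 ++ b :: s2) a)) //.
  rewrite rcons_cat cat_path rcons_cons [path _ _ (b :: _)]/= rcons_path.
  by move=> /and4P[].
exfalso; pose q (i : 'I_3) := nth [::] [:: p; s1; s2] i.
pose c (i : 'I_3) := last a (q i).
have u3 : uniq (a :: b :: p ++ s1 ++ s2).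
  have : uniq ((a :: s1 ++ b :: s2) ++ p) by rewrite cat_uniq up dis !andbT.
  have perm3 l1 l2 l3 : perm_eq ((a :: l1 ++ b :: l2) ++ l3) (a :: b :: l3 ++ l1 ++ l2).
    by apply/permP => f; rewrite /= !count_cat /= ?count_cat /=; clear; lia.
  by rewrite (perm_uniq (perm3 _ _ _)).
have [aq bq ab_ne] : [/\ forall i, a \notin q i, forall i, b \notin q i & a != b].
  move: u3; rewrite !cons_uniq inE negb_or !mem_cat !negb_or.
  move=> /and3P[/and4P[anb ap as1 as2] /and3P[bp bs1 bs2] _].
  by split=> // -[[|[|[|//]]] hi].
have qq i j z : i != j -> z \in q i -> z \in q j -> False.
  move: u3; rewrite !cons_uniq !cat_uniq => /and3P[_ _ /and4P[_ /hasPn h1 _ /andP[/hasPn h2 _]]].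
  have hp1 y : y \in s1 -> y \in p -> False by move=> h; apply/negP/h1; rewrite mem_cat h.
  have hp2 y : y \in s2 -> y \in p -> False by move=> h; apply/negP/h1; rewrite mem_cat h orbT.
  have h12 y : y \in s2 -> y \in s1 -> False by move=> h; apply/negP/h2.
  case: i j => [[|[|[|//]]] hi] [[|[|[|//]]] hj] // _ zi zj; rewrite /q /= in zi zj.
  - exact: (hp1 z).
  - exact: (hp2 z).
  - exact: (hp1 z).
  - exact: (h12 z).
  - exact: (hp2 z).
  - exact: (h12 z).
have cq i : c i \in q i.
  have last_in l : l != [::] -> last a l \in l by case: l => // x l _; exact: (mem_last x l).
  by case: i => [[|[|[|//]]] hi]; rewrite /c /q; apply: last_in.
apply: (theta (a := a) (b := b) (c := c)
  (A := fun i => if val i == 2 then [:: c i] else q i)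
  (B := fun i => if val i == 2 then q i else [:: c i])).
- case=> [[|[|[|//]]] hi]; split=> //=.
  by rewrite adjC andbT /c /q /=; case: (s2) s2_n ba.
- case=> [[|[|[|//]]] hi]; split=> //=.
  + by rewrite andbT adjC; exact: pb.
  + by rewrite andbT adjC; exact: ab.
  + by rewrite /c /q /=; case: (s2) s2_n.
move=> i j ij; apply/hasPn => z; rewrite !inE.
have hA : z \in (if val i == 2 then [:: c i] else q i) -> z \in q i.
  by case: ifP => _ //; rewrite inE => /eqP->.
have hB : z \in (if val j == 2 then q j else [:: c j]) -> z \in q j.
  by case: ifP => _ //; rewrite inE => /eqP->.
move=> zA; apply/negP => /= zB; move: zA zB.
case/orP=> [/eqP za|/hA zi] /orP[/eqP zb|/hB zj].
- by rewrite -za zb eqxx in ab_ne.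
- by move: (aq j); rewrite -za zj.
- by move: (bq i); rewrite -zb zi.
- exact: qq ij zi zj.
Qed.

(** Removing any one vertex leaves [S] connected. *)
Definition unseparated S := forall x A, x \in S -> A != set0 -> A \proper S :\ x ->
  exists y z, [/\ y \in A, z \in (S :\ x) :\: A & adj y z].

(** Let [D] be a component of the rest of [S]. No single vertex separates it
from the cycle, so that it has neighbours at two vertices [a] and [b] of the
cycle. An ear through [D] joins them; its ends are consecutive by
[ear_consecutive], hence it can replace an edge of the cycle. *)
Lemma longer_cycle S C z : unseparated S -> ucycle (@adj G) C -> 1 < size C ->
  {subset C <= S} -> z \in S -> z \notin C ->
  exists C', [/\ ucycle (@adj G) C', size C < size C' & {subset C' <= S}].
Proof.
move=> unsep Cc C1 CS zS zC.
pose out y := (y \in S) && (y \notin C).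
pose r := [rel x y | [&& adj x y, out x & out y]].
have r_sym : symmetric r by move=> x y; rewrite /= adjC; case: (adj _ _); case: (out x); case: (out y).
have conn_sym x y : connect r x y = connect r y x by exact: (sym_connect_sym r_sym).
pose D := [set y | connect r z y].
have outz : out z by rewrite /out zS.
have path_out x p : out x -> path r x p -> all out (x :: p).
  elim: p x => [|y p IH] x /= ox; first by rewrite ox.
  by case/andP=> /and3P[_ _ oy] /(IH _ oy) /= ->; rewrite ox.
have D_out y : y \in D -> out y.
  rewrite inE => /connectP[p pz ->].
  exact: (allP (path_out _ _ outz pz)) (mem_last _ _).
have leave x : x \in C -> exists d y, [/\ d \in D, y \in C, y != x & adj d y].
  move=> xC; have [||d [y [dD]]] := unsep x D (CS x xC).
  - by apply/set0Pn; exists z; rewrite inE connect0.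
  - rewrite properE; apply/andP; split.
      apply/subsetP => y /D_out /andP[yS yC]; rewrite !inE yS andbT.
      by apply: contraNneq yC => ->.
    have [y yC yx] : exists2 y, y \in C & y != x.
      case/andP: Cc => _; case: (C) xC C1 => [|c1 [|c2 l]] // xC _ /= /andP[].
      rewrite inE negb_or => /andP[c12 _] _.
      have [e|ne] := eqVneq c1 x; last by exists c1; rewrite ?inE ?eqxx.
      by exists c2; rewrite ?inE ?eqxx ?orbT // -e eq_sym.
    apply/subsetPn; exists y; first by rewrite !inE yx CS.
    by apply/negP => /D_out; rewrite /out yC andbF.
  rewrite !inE => /and3P[yD yx yS] dy; exists d, y; split=> //.
  apply: contraR yD => yC; move: (dD); rewrite inE => /connect_trans; apply.
  by apply: connect1; rewrite /= dy (D_out _ dD) /out yS yC.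
have Dear d d' x y : d \in D -> d' \in D -> adj x d -> adj d' y ->
    exists p, [/\ ear x y p, uniq p, p != [::], {subset p <= S} & ~~ has [in C] p].
  move=> dD d'D xd dy.
  have : connect r d d'.
    by move: dD d'D; rewrite !inE conn_sym => h1 h2; apply: connect_trans h1 h2.
  case/connectP=> p0 p0P e; case/shortenP: p0P e => p pP up _ e.
  have allp := path_out _ _ (D_out _ dD) pP.
  exists (d :: p); split=> //.
  - rewrite /ear /= xd rcons_path -e dy andbT.
    by apply: sub_path pP => u v /and3P[].
  - by move=> u /(allP allp) /andP[].
  - by apply/hasPn => u /(allP allp) /andP[].
have [c0 c0C] : exists c0, c0 \in C by case: (C) C1 => // c0 l _; exists c0; rewrite mem_head.
have [d [a [dD aC _ da]]] := leave c0 c0C.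
have [d' [b [d'D bC ba d'b]]] := leave a aC.
have [i C0 eC] := rot_to aC.
have C0c : ucycle (@adj G) (a :: C0).
  by rewrite -eC /ucycle rot_cycle rot_uniq.
have C0m : a :: C0 =i C by move=> u; rewrite -eC mem_rot.
have sz : size C = (size C0).+1 by rewrite -(size_rot i C) eC.
have : b \in C0 by move: bC; rewrite -C0m inE (negbTE ba).
case/splitPr eC0 : _ / => [s1 s2]; subst C0.
have [p [ep up p0 pS pC]] := Dear d d' a b dD d'D (etrans (adjC _ _) da) d'b.
have pC0 : ~~ has [in a :: s1 ++ b :: s2] p by rewrite (eq_has C0m).
case: (ear_consecutive C0c ep up pC0) => e; first by rewrite e in p0.
- subst s1; exists (a :: p ++ b :: s2); split; first exact: cycle_extend.
    rewrite sz /= size_cat /=; case: (p) p0 => //= ? ? _; clear; lia.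
  move=> u; rewrite inE mem_cat => /or3P[/eqP->|/pS//|us]; first exact: CS.
  by apply: CS; rewrite -C0m inE us orbT.
- subst s2.
  have [p' [ep' up' p0' pS' pC']] := Dear d' d b a d'D dD (etrans (adjC _ _) d'b) da.
  have C1c : ucycle (@adj G) (b :: a :: s1).
    have : ucycle (@adj G) (rot (size s1).+1 (a :: s1 ++ [:: b])) by rewrite /ucycle rot_cycle rot_uniq.
    by rewrite -[(size s1).+1]/(size (a :: s1)) -cat_cons rot_size_cat.
  have m1 : b :: a :: s1 =i C.
    by move=> u; rewrite -C0m !inE mem_cat inE; case: (u == a); case: (u == b); rewrite ?orbT ?orbF.
  exists (b :: p' ++ a :: s1); split.
  + by apply: cycle_extend => //; rewrite (eq_has m1).
  + rewrite sz /= !size_cat /=; case: (p') p0' => //= ? ? _; clear; lia.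
  move=> u; rewrite inE mem_cat => /or3P[/eqP->|/pS'//|us]; first exact: CS.
  by apply: CS; rewrite -m1 inE us orbT.
Qed.

Hypothesis K4 : K4_free G.

(** The two chords and the four arcs of the cycle are a subdivided K_4. *)
Lemma crossing_chords (a b c d : G) (x1 x2 x3 y : seq G) :
  ucycle (@adj G) (a :: x1 ++ b :: x2 ++ c :: x3 ++ d :: y) ->
  adj a c -> adj b d -> False.
Proof.
move=> /andP[cyc un] ac bd.
(* multiplicities turn the disjointness of the paths into linear arithmetic *)
have [cm [mem_cm cm_cons cm_cat cm_rev cm_uniq]] : exists cm : G -> seq G -> nat,
  [/\ forall z s, (z \in s) = (0 < cm z s),
      forall z u s, cm z (u :: s) = cm z [:: u] + cm z s,
      forall z s t, cm z (s ++ t) = cm z s + cm z t,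
      forall z s, cm z (rev s) = cm z s &
      forall z s, uniq s -> cm z s <= 1].
  exists (fun z s => count_mem z s); split=> [z s|z u s|z s t|z s|z s us].
  - by rewrite -has_count has_pred1.
  - by rewrite /= addn0.
  - exact: count_cat.
  - exact: count_rev.
  - by rewrite count_uniq_mem // leq_b1.
have cm_self z : 0 < cm z [:: z] by rewrite -mem_cm mem_head.
have key z : cm z [:: a] + cm z [:: b] + cm z [:: c] + cm z [:: d] + cm z x1 +
    cm z x2 + cm z x3 + cm z y <= 1.
  have := cm_uniq z _ un; rewrite cm_cons cm_cat (cm_cons _ b) cm_cat (cm_cons _ c).
  rewrite cm_cat (cm_cons _ d); clear; lia.
have cm_rcons z s u : cm z (rcons s u) = cm z s + cm z [:: u] by rewrite -cats1 cm_cat.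
have [pab pbc pcd pda] : [/\ path (@adj G) a (rcons x1 b), path (@adj G) b (rcons x2 c),
    path (@adj G) c (rcons x3 d) & path (@adj G) d (rcons y a)].
  move: cyc; rewrite [cycle _ _]/= rcons_cat cat_path rcons_cons [path _ _ (b :: _)]/=.
  rewrite rcons_cat cat_path rcons_cons [path _ _ (c :: _)]/=.
  rewrite rcons_cat cat_path rcons_cons [path _ _ (d :: _)]/=.
  rewrite (rcons_path _ a) (rcons_path _ b) (rcons_path _ c).
  by move=> /and3P[-> -> /and3P[-> -> /and3P[-> -> ->]]].
pose v i := nth a [:: a; b; c; d] i.
pose P i j := match i, j with
  | 0, 1 => rcons x1 b | 0, 2 => [:: c] | 0, _ => rev (d :: y)
  | 1, 2 => rcons x2 c | 1, _ => [:: d] | _, _ => rcons x3 d end.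
apply: (K4 (c := v) (P := P)).
- move=> i j /andP[]; case: i j => [|[|[|i]]] [|[|[|[|j]]]] //= _ _; rewrite /v /P /=;
    rewrite ?last_rcons ?ac ?bd //.
  rewrite rev_cons last_rcons; split=> //.
  have := rev_path (@adj G) d (rcons y a); rewrite last_rcons belast_rcons rev_cons => ->.
  by rewrite (eq_path (e' := @adj G)) // => u u'; rewrite adjC.
- move=> i j /andP[]; case: i j => [|[|[|i]]] [|[|[|[|j]]]] //= _ _; rewrite /v /=;
    apply/negP => /eqP e; move: (key a) (key b) (key c) (cm_self a) (cm_self b) (cm_self c);
    rewrite ?e; clear; lia.
- move=> i j k /andP[ij j4] k4 ki kj; rewrite mem_cm -leqNgt.
  move: (key (v k)) (cm_self (v k)); rewrite (cm_cons _ (v i)).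
  case: i j ij j4 ki kj => [|[|[|i]]] [|[|[|[|j]]]] //= _ _; rewrite /v /P;
    case: k k4 => [|[|[|[|k]]]] //= _ _ _; rewrite ?rev_cons ?cm_rcons ?cm_rev; clear; lia.
- move=> i j k l /andP[ij j4] ik /andP[kl l4] jk jl; apply/hasPn => z; rewrite mem_cm => h.
  change (z \notin v k :: P k l); rewrite mem_cm; move: (key z) h; rewrite (cm_cons z (v i)) (cm_cons z (v k)).
  case: i j ij j4 ik jk jl => [|[|[|i]]] [|[|[|[|j]]]] //= _ _;
    case: k l kl l4 => [|[|[|k]]] [|[|[|[|l]]]] //= _ _ _ _ _; rewrite /v /P;
    rewrite /= ?rev_cons ?cm_rcons ?cm_rev; clear; lia.
Qed.

Lemma split_index s a : uniq s -> index a s < size s ->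
  exists s1 s2, [/\ s = s1 ++ a :: s2, uniq s2 &
    forall y, index a s < index y s -> index y s = (size s1 + index y s2).+1].
Proof.
move=> us; rewrite index_mem => as_; move: us.
case/splitPr: as_ => s1 s2 us; exists s1, s2.
move: (us); rewrite cat_uniq cons_uniq => /and3P[_ /hasPn h /andP[a2 u2]].
have a1 : a \notin s1 by apply: h; rewrite mem_head.
split=> // y; rewrite !index_cat (negbTE a1) /= eqxx addn0.
case: ifP => [ys|_]; first by rewrite ltnNge ltnW // index_mem.
by case: eqP => [_|_]; rewrite ?addn0 ?ltnn // addnS.
Qed.

Lemma ucycle_noncrossing C : ucycle (@adj G) C -> noncrossing C.
Proof.
move=> Cc a b c d ab bc cd dC ac; apply/negP => bd.
have [_ uC] := andP Cc.
have hc := ltn_trans cd dC; have hb := ltn_trans bc hc; have ha := ltn_trans ab hb.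
have [x0 [s1 [e1 u1 i1]]] := split_index uC ha.
have bd_ := ltn_trans bc cd; have ac_ := ltn_trans ab bc; have ad_ := ltn_trans ab bd_.
have sz : size C = (size x0 + size s1).+1 by rewrite e1 size_cat /= addnS.
rewrite (i1 b) // (i1 c) // ltnS ltn_add2l in bc.
rewrite (i1 c) // (i1 d) // ltnS ltn_add2l in cd.
rewrite (i1 d) // sz ltnS ltn_add2l in dC.
have [x1 [s2 [e2 u2 i2]]] := split_index u1 (ltn_trans bc (ltn_trans cd dC)).
have bd1 := ltn_trans bc cd.
have sz2 : size s1 = (size x1 + size s2).+1 by rewrite e2 size_cat /= addnS.
rewrite (i2 c) // (i2 d) // ltnS ltn_add2l in cd.
rewrite (i2 d) // sz2 ltnS ltn_add2l in dC.
have [x2 [s3 [e3 u3 i3]]] := split_index u2 (ltn_trans cd dC).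
have : d \in s3 by rewrite -index_mem; move: dC; rewrite (i3 d) // e3 size_cat /= addnS ltnS ltn_add2l.
case/splitPr eq3 : _ / => [x3 x4].
apply: (@crossing_chords a b c d x1 x2 x3 (x4 ++ x0)) => //.
have : ucycle (@adj G) (rot (size x0) C) by rewrite /ucycle rot_cycle rot_uniq.
by rewrite e1 rot_size_cat e2 e3 eq3 /= -!catA /= -!catA /= -!catA.
Qed.

(** An edge counts as a cycle of length two, and it can be lengthened until
nothing of [S] is left out. *)
Lemma spanning_cycle S : unseparated S -> 2 < #|S| ->
  exists C, ucycle (@adj G) C /\ C =i S.
Proof.
move=> unsep S2.
have [C [Cc C1 CS]] : exists C, [/\ ucycle (@adj G) C, 1 < size C & {subset C <= S}].
  have [x xS] : exists x, x \in S by apply/set0Pn; rewrite -card_gt0; apply: leq_trans S2.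
  have Sx : 1 < #|S :\ x| by move: S2; rewrite (cardsD1 x) xS.
  have [y yS] : exists y, y \in S :\ x by apply/set0Pn; rewrite -card_gt0; apply: leq_trans Sx.
  have [||u [v [uy vS uv]]] := unsep x [set y] xS.
  - by apply/set0Pn; exists y; rewrite inE.
  - by rewrite properEcard sub1set yS cards1.
  exists [:: u; v]; split=> //=.
    rewrite /ucycle /= uv adjC uv inE !andbT /=.
    by apply/negP => /eqP e; rewrite e adj_irrefl in uv.
  move=> t; move: uy vS yS; rewrite !inE => /eqP-> /andP[_ /andP[_ vS]] /andP[_ yS].
  by case/orP=> /eqP->.
have [n] := ubnP (#|S| - size C); elim: n C Cc C1 CS => // n IH C Cc C1 CS lt.
have [full|] := boolP (S \subset C).
  exists C; split=> // y; apply/idP/idP => [/CS//|]; exact: (subsetP full).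
case/subsetPn => z zS zC; have [C' [Cc' C'1 CS']] := longer_cycle unsep Cc C1 CS zS zC.
apply: (IH C') => //; first exact: ltn_trans C1 C'1.
have [_ uC'] := andP Cc'.
have : size C' <= #|S| by rewrite -(card_uniqP uC'); apply/subset_leq_card/subsetP.
by move: lt C'1; clear; lia.
Qed.

(** If some vertex [x] separates [S], then the two sides are ordered by induction
and glued at [x]; otherwise the order comes from a spanning cycle. *)
Lemma noncrossing_order S :
  exists s, [/\ uniq s, s =i S & noncrossing s].
Proof.
have [n] := ubnP #|S|; elim: n S => // n IH S; rewrite ltnS => Sn.
have [S2|S2] := leqP #|S| 2.
  exists (enum S); split; [exact: enum_uniq|exact: mem_enum|].
  by apply: noncrossing_small; rewrite -cardE leqW.
have [sep|nsep] := boolP [exists x in S, exists A : {set G},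
    [&& A != set0, A \proper S :\ x &
        [forall y in A, forall z in (S :\ x) :\: A, ~~ adj y z]]]; last first.
  have unsep : unseparated S.
    move=> x A xS A0 AS; move: nsep; rewrite negb_exists_in => /forall_inP/(_ x xS).
    rewrite negb_exists => /forallP/(_ A); rewrite A0 AS /= negb_forall_in.
    case/exists_inP => y yA; rewrite negb_forall_in => /exists_inP[z zS].
    by rewrite negbK => yz; exists y, z.
  have [C [Cc CS]] := spanning_cycle unsep S2; exists C; split=> //.
    by case/andP: Cc.
  exact: ucycle_noncrossing.
case/exists_inP: sep => x xS /existsP[A /and3P[A0 AS /forall_inP no]].
pose B := (S :\ x) :\: A.
have piece (A' : {set G}) : A' \proper S :\ x ->
    exists s, [/\ uniq (x :: s), s =i A' & noncrossing (x :: s)].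
  move=> A'S; have xA' : x \notin A'.
    by apply/negP => /(subsetP (proper_sub A'S)); rewrite !inE eqxx.
  have [|s [us sA nc]] := IH (x |: A').
    rewrite cardsU1 xA' -[_ < n]/(_ <= n) (leq_trans _ Sn) //.
    by have := proper_card A'S; rewrite [#|S|](cardsD1 x) xS.
  have [|i s' e] := @rot_to _ s x; first by rewrite sA !inE eqxx.
  have us' : uniq (x :: s') by rewrite -e rot_uniq.
  exists s'; split=> //; last by rewrite -e; apply: noncrossing_rot.
  move=> y; have := sA y; rewrite -(mem_rot i) e !inE.
  have [->|//] := eqVneq y x; rewrite (negbTE xA') => _.
  by apply/negbTE; case/andP: us'.
have AsubS := proper_sub AS.
have BS : B \proper S :\ x.
  rewrite properEcard subsetDl /= (cardsD (S :\ x) A) (setIidPr AsubS).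
  by move: A0 (subset_leq_card AsubS); rewrite -card_gt0; clear; lia.
have [sA [uA mA ncA]] := piece A AS; have [sB [uB mB ncB]] := piece B BS.
exists (x :: sA ++ sB); have u : uniq (x :: sA ++ sB).
  move: uA uB => /= /andP[xA uA] /andP[xB uB].
  rewrite mem_cat negb_or xA xB cat_uniq uA uB !andbT /=.
  by apply/hasPn => y; rewrite /= mB mA inE => /andP[].
split=> //.
  move=> y; rewrite inE mem_cat mA mB !inE.
  have [->|yx] := eqVneq y x; first by rewrite xS.
  by have := subsetP AsubS y; rewrite !inE yx /=; case: (y \in A) => //= ->.
apply: noncrossing_glue => // y z; rewrite mA mB => yA zB.
exact: (forall_inP (no y yA)).
Qed.

End NoncrossingOrder.

(** * Distances *)

Section Distance.
Variable G : sgraph.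
Hypothesis conn : graph_connected G.
Implicit Types x y z : G.

Lemma gdist_walk x y : exists p, [/\ path (@adj G) x p, last x p = y & size p = gdist x y].
Proof.
have /existsP[p /andP[pP /eqP e]] := has_walk_gdist (conn x y).
by exists p; split; rewrite ?size_tuple.
Qed.

Lemma gdist_le_walk x p : path (@adj G) x p -> gdist x (last x p) <= size p.
Proof.
move=> pP; apply: gdist_min; apply/existsP; exists (in_tuple p).
by rewrite pP eqxx.
Qed.

Lemma gdistxx x : gdist x x = 0.
Proof. by apply/eqP; rewrite gdist_eq0. Qed.

Lemma gdist_triangle y x z : gdist x z <= gdist x y + gdist y z.
Proof.
have [p [pP <- <-]] := gdist_walk x y; have [q [qP <- <-]] := gdist_walk (last x p) z.
by rewrite -last_cat -size_cat gdist_le_walk // cat_path pP.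
Qed.

Lemma gdistC x y : gdist x y = gdist y x.
Proof.
suff le (u v : G) : gdist v u <= gdist u v by apply/eqP; rewrite eqn_leq !le.
have [p [pP <- <-]] := gdist_walk u v.
have := @gdist_le_walk (last u p) (rev (belast u p)).
rewrite rev_path size_rev size_belast (eq_path (e' := @adj G)); last by move=> ? ?; rewrite adjC.
move=> /(_ pP); congr (gdist _ _ <= _); case: p {pP} => // a p.
by rewrite /= rev_cons last_rcons.
Qed.

Lemma gdist_adj x y : adj x y -> gdist x y = 1.
Proof.
move=> xy; apply/eqP; rewrite eqn_leq lt0n gdist_eq0.
have := @gdist_le_walk x [:: y]; rewrite /= xy => -> //=.
by apply/eqP => e; rewrite e adj_irrefl in xy.
Qed.

Lemma gdist_pred x y n : gdist x y = n.+1 -> exists2 z, adj z y & gdist x z = n.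
Proof.
move=> d; have [p [pP e sz]] := gdist_walk x y; rewrite d in sz.
case/lastP: p => [|p z] in pP e sz *; first by [].
rewrite size_rcons in sz; case: sz => sz; rewrite last_rcons in e; subst z.
move: pP; rewrite rcons_path => /andP[pP py]; exists (last x p) => //.
apply/eqP; rewrite eqn_leq -{1}sz gdist_le_walk //=.
by have := gdist_triangle (last x p) x y; rewrite d (gdist_adj py) addn1 ltnS.
Qed.

Lemma gdist1 x y : gdist x y = 1 -> adj x y.
Proof.
by move=> /gdist_pred[z zy] /eqP; rewrite gdist_eq0 => /eqP->.
Qed.

Lemma gdist2 x y : gdist x y = 2 -> exists2 m, adj x m & adj m y.
Proof. by move=> /gdist_pred[z zy] /gdist1 xz; exists z. Qed.

Lemma adj_gdist z x y : adj x y -> gdist z y <= (gdist z x).+1.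
Proof. by move=> xy; have := gdist_triangle x z y; rewrite (gdist_adj xy) addn1. Qed.

Lemma geodesic x y : exists p, [/\ path (@adj G) x p, last x p = y &
  forall z, z \in x :: p -> gdist x z + gdist z y = gdist x y].
Proof.
have [p [pP e sz]] := gdist_walk x y; exists p; split=> // z zp.
apply/eqP; rewrite eqn_leq gdist_triangle andbT.
case/splitPl: zp => p1 p2 ez in pP e sz *.
move: pP; rewrite cat_path ez => /andP[h1 h2]; rewrite last_cat ez in e.
have a1 := gdist_le_walk h1; have a2 := gdist_le_walk h2.
by rewrite ez in a1; rewrite e in a2; rewrite -sz size_cat leq_add.
Qed.

End Distance.

(** * Rightmost geodesics *)

Section Sweep.
Variable G : sgraph.
Hypothesis conn : graph_connected G.
Implicit Types x y z u w p q : G.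

Variable rank : G -> nat.
Hypothesis rank_inj : injective rank.
Hypothesis nc : forall a b c d, rank a < rank b -> rank b < rank c -> rank c < rank d ->
  adj a c -> ~~ adj b d.
Variable r : G.
Hypothesis rank_r : rank r = 0.

Let lt x y := rank x < rank y.

Lemma lt_total x y : x != y -> lt y x = ~~ lt x y.
Proof.
move=> /eqP ne; rewrite /lt -leqNgt [RHS]leq_eqVlt.
by case: eqP => // /rank_inj e; case: ne.
Qed.

Lemma edges_dont_cross x y u w : adj x y -> adj u w ->
  x != u -> x != w -> y != u -> y != w ->
  lt x u (+) lt y u (+) lt x w (+) lt y w = false.
Proof.
wlog xy' : x y / lt x y => [wl xy uw xu xw yu yw|].
  have xny : x != y by apply/eqP => e; rewrite e adj_irrefl in xy.
  have [h|h] := boolP (lt x y); first exact: wl.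
  rewrite -(lt_total xny) in h; have := wl y x h _ uw yu yw xu xw.
  rewrite adjC xy => /(_ isT).
  by case: (lt x u); case: (lt y u); case: (lt x w); case: (lt y w).
wlog uw' : u w / lt u w => [wl xy uw xu xw yu yw|].
  have unw : u != w by apply/eqP => e; rewrite e adj_irrefl in uw.
  have [h|h] := boolP (lt u w); first exact: wl.
  rewrite -(lt_total unw) in h; have := wl w u h xy _ xw xu yw yu.
  rewrite adjC uw => /(_ isT).
  by case: (lt x u); case: (lt y u); case: (lt x w); case: (lt y w).
move=> xy uw xu xw yu yw.
have ne a b : a != b -> rank a <> rank b by move=> /eqP h /rank_inj.
move: (ne _ _ xu) (ne _ _ xw) (ne _ _ yu) (ne _ _ yw) xy' uw'.
have : ~ [/\ rank x < rank u, rank u < rank y & rank y < rank w].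
  by move=> [h1 h2 h3]; have := nc h1 h2 h3 xy; rewrite uw.
have : ~ [/\ rank u < rank x, rank x < rank w & rank w < rank y].
  by move=> [h1 h2 h3]; have := nc h1 h2 h3 uw; rewrite xy.
rewrite /lt; move: (rank x) (rank y) (rank u) (rank w) => a b c d n1 n2 ac ad bc bd ab cd.
case: (ltnP a c) => h1; case: (ltnP b c) => h2; case: (ltnP a d) => h3;
  case: (ltnP b d) => h4 //; try (clear n1 n2; lia).
  by case: n2; split=> //; lia.
by case: n1; split=> //; lia.
Qed.

Lemma edge_path_dont_cross x y u (t : seq G) : adj x y -> path (@adj G) u t ->
  x \notin u :: t -> y \notin u :: t ->
  lt x u (+) lt y u (+) lt x (last u t) (+) lt y (last u t) = false.
Proof.
move=> xy; elim: t u => [|w t IH] u /=.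
  by move=> _ _ _; case: (lt x u); case: (lt y u).
move=> /andP[uw wt] xt0 yt0.
have [xu xt] : x != u /\ x \notin w :: t by move: xt0; rewrite inE negb_or => /andP[].
have [yu yt] : y != u /\ y \notin w :: t by move: yt0; rewrite inE negb_or => /andP[].
have xw : x != w by apply: contraNneq xt => ->; rewrite mem_head.
have yw : y != w by apply: contraNneq yt => ->; rewrite mem_head.
have := f_equal2 addb (IH w wt xt yt) (edges_dont_cross xy uw xu xw yu yw).
by move/parity_trans; apply; rewrite !addb_xorb; btauto.
Qed.

(** Whether the ends of one path separate the ends of the other is additive
modulo 2 in the edges of both paths. *)
Lemma paths_dont_cross x (s : seq G) u (t : seq G) :
  path (@adj G) x s -> path (@adj G) u t ->
  (forall z, z \in x :: s -> z \notin u :: t) ->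
  lt x u (+) lt (last x s) u (+) lt x (last u t) (+) lt (last x s) (last u t) = false.
Proof.
move=> + ut; elim: s x => [|y s IH] x /=.
  by move=> _ _; case: (lt x u); case: (lt x (last u t)).
move=> /andP[xy ys] dis.
have h1 := IH y ys (fun z zs => dis z (mem_behead (s := x :: y :: s) zs)).
have h2 := edge_path_dont_cross xy ut (dis x (mem_head _ _)) (dis y (mem_behead (s := x :: y :: s) (mem_head y s))).
have := f_equal2 addb h1 h2.
by move/parity_trans; apply; rewrite !addb_xorb; btauto.
Qed.

Local Notation level x := (gdist r x).
(** [z] lies on a geodesic from the root to [u]. *)
Definition anc u z := level z + gdist z u == level u.

(** The root comes first, so that a geodesic from [u] to the root leads out of
the interval between the ends of the path. *)
Lemma path_under x (s : seq G) u : path (@adj G) x s ->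
  lt x u (+) lt (last x s) u -> exists2 z, z \in x :: s & anc u z.
Proof.
move=> xs sep; have [t [ut e tg]] := geodesic conn u r.
have [/hasP[z zt zs]|/hasPn dis] := boolP (has [in x :: s] (u :: t)).
  exists z => //; have := tg z zt.
  by rewrite /anc ![gdist _ r]gdistC // gdistC // addnC => ->.
have rxs : r \notin x :: s by apply: dis; rewrite -e mem_last.
have dis' z : z \in x :: s -> z \notin u :: t by move=> zs; apply: contraL zs; exact: dis.
have := paths_dont_cross xs ut dis'.
have pos y : y \in x :: s -> lt y r = false by rewrite /lt rank_r ltn0.
by rewrite e !pos ?mem_head ?mem_last // !addbF sep.
Qed.


Definition parent x y := adj x y && ((level y).+1 == level x).

Lemma parent_adj x y : parent x y -> adj x y. Proof. by case/andP. Qed.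
Lemma parent_level x y : parent x y -> (level y).+1 = level x.
Proof. by case/andP => _ /eqP. Qed.

Lemma anc_level u z : anc u z -> level z <= level u.
Proof. by move=> /eqP <-; exact: leq_addr. Qed.

Lemma anc_same_level u z : anc u z -> level u <= level z -> z = u.
Proof.
move=> /eqP <-; rewrite -[leqRHS]addn0 leq_add2l leqn0 gdist_eq0.
by move/eqP.
Qed.

(** Of two parents on the same side of [x], the inner one is shut in by the edge
from [x] to the outer one, and could reach the root only through vertices that
are no closer to it. *)
Lemma parent_side_uniq x y y' : parent x y -> parent x y' -> lt x y = lt x y' ->
  y = y'.
Proof.
wlog yy : y y' / lt y y' => [wl h h' e|h h' e].
  have [->//|ne] := eqVneq y y'.
  have [lty|] := boolP (lt y y'); first exact: wl.
  by rewrite -(lt_total ne) => lty; apply/esym/wl.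
have xy : x != y by apply/eqP => exy; have := parent_adj h; rewrite exy adj_irrefl.
have xy' : x != y' by apply/eqP => exy; have := parent_adj h'; rewrite exy adj_irrefl.
have [lv lv'] := (parent_level h, parent_level h').
pose inner := if lt x y then y else y'; pose outer := if lt x y then y' else y.
have [pi po] : parent x inner /\ parent x outer by rewrite /inner /outer; case: ifP.
have ll : level inner = level outer by rewrite /inner /outer; case: ifP; lia.
have xs : path (@adj G) x [:: outer] by rewrite /= (parent_adj po).
have sep : lt x inner (+) lt outer inner.
  rewrite /inner /outer; case: ifPn => h1.
    by rewrite h1; have -> : lt y' y = false by apply/negbTE; rewrite -leqNgt ltnW.
  by rewrite -e (negbTE h1).
have [z] := path_under xs sep; rewrite !inE => /orP[]/eqP-> anc_z.
  by have := anc_level anc_z; rewrite -(parent_level pi) ltnn.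
have : outer = inner by apply: anc_same_level anc_z _; rewrite ll.
by rewrite /inner /outer; case: ifP.
Qed.

(** In the circular order from [x] upwards, a parent above [x] comes before one
below [x]; preferring it keeps the geodesic as far to the right as possible. *)
Definition par x := odflt x (if [pick y | parent x y & lt x y] is Some y then Some y
  else [pick y | parent x y]).

Lemma par_parent x : 0 < level x -> parent x (par x).
Proof.
move=> lx; rewrite /par; case: pickP => [y /andP[]//|_].
case: pickP => [//|no].
have [z zx e] := gdist_pred conn (esym (prednK lx)).
by have := no z; rewrite /parent adjC zx e prednK // eqxx.
Qed.

Lemma par_greater x y : parent x y -> lt x y -> lt x (par x).
Proof.
move=> h xy; rewrite /par; case: pickP => [z /andP[]//|no].
by have := no y; rewrite h xy.
Qed.

Lemma parent_pos x y : parent x y -> 0 < level x.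
Proof. by move/parent_level <-. Qed.

Lemma level0 x : level x = 0 -> x = r.
Proof. by move/eqP; rewrite gdist_eq0 => /eqP. Qed.

(** The vertex set of the rightmost geodesic from the root to [p]. *)
Definition rail p x := x \in traject par p (level p).+1.

Lemma railE p x : rail p x = (x == p) || (0 < level p) && rail (par p) x.
Proof.
rewrite {1}/rail trajectS inE; case: posnP => [->|lp]; first by rewrite /= in_nil.
by rewrite /rail (parent_level (par_parent lp)).
Qed.

Lemma railxx p : rail p p. Proof. by rewrite railE eqxx. Qed.

Lemma rail_ind (Q : G -> Prop) : (forall p, (0 < level p -> Q (par p)) -> Q p) ->
  forall p, Q p.
Proof.
move=> step p; have [n] := ubnP (level p); elim: n p => // n IH p ltn.
apply: step => lp; apply: IH; move: (parent_level (par_parent lp)) ltn.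
by move=> <-; rewrite ltnS.
Qed.

Lemma rail_path p : exists s, [/\ path (@adj G) p s, last p s = r &
  forall z, z \in p :: s -> rail p z].
Proof.
elim/rail_ind: p => p IH; have [l0|lp] := posnP (level p).
  exists [::]; split=> //; first by rewrite /= (level0 l0).
  by move=> z; rewrite inE => /eqP->; exact: railxx.
have [s [ps e h]] := IH lp; exists (par p :: s); split=> //.
  by rewrite /= (parent_adj (par_parent lp)).
move=> z; rewrite inE railE => /orP[->//|/h ->]; by rewrite lp orbT.
Qed.

Lemma anc_step p q z : parent p q -> anc q z -> anc p z.
Proof.
move=> pq /eqP e; have qp : adj q p by rewrite adjC parent_adj.
have := parent_level pq; have := adj_gdist conn z qp; have := gdist_triangle conn z r p.
by move: e => <- h1 h2 h3; apply/eqP; move: h1 h2 h3; clear; lia.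
Qed.

Lemma rail_anc p x : rail p x -> anc p x.
Proof.
elim/rail_ind: p => p IH; rewrite railE => /orP[/eqP->|/andP[lp /(IH lp)]].
  by rewrite /anc gdistxx // addn0.
exact: anc_step (par_parent lp).
Qed.

Lemma rail_par p x : rail p x -> 0 < level x -> rail p (par x).
Proof.
elim/rail_ind: p => p IH; rewrite [rail p x]railE => /orP[/eqP-> lp|/andP[lp h] lx].
  by rewrite railE lp railxx orbT.
by rewrite railE lp IH // orbT.
Qed.

Lemma rail_level p x y : rail p x -> rail p y -> level x = level y -> x = y.
Proof.
elim/rail_ind: p => p IH hx hy lxy.
have top z : rail p z -> level z = level p -> z = p.
  by move=> /rail_anc h e; apply: anc_same_level h _; rewrite e.
move: (hx) (hy); rewrite [rail p x]railE [rail p y]railE.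
case/orP=> [/eqP ex _|/andP[lp h]]; first by rewrite ex; apply/esym/top; rewrite // -lxy ex.
case/orP=> [/eqP ey|/andP[_ h']]; first by rewrite ey; apply: top; rewrite // lxy ey.
exact: IH.
Qed.

Lemma anc_pred q y : anc q y -> y != q -> exists2 z, parent q z & anc z y.
Proof.
move=> /eqP e ne; have d0 : 0 < gdist y q by rewrite lt0n gdist_eq0.
have [z zq dz] := gdist_pred conn (esym (prednK d0)); exists z.
  rewrite /parent adjC zq; apply/eqP/anti_leq; rewrite andbC.
  rewrite (adj_gdist conn) //=; have := gdist_triangle conn y r z; rewrite dz -e.
  by move: (prednK d0); clear; lia.
have := gdist_triangle conn y r z; have := adj_gdist conn r zq; rewrite /anc dz -e.
by move: (prednK d0); clear; lia.
Qed.

Lemma anc_trans u z y : anc z u -> anc u y -> anc z y.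
Proof.
move=> /eqP e /eqP e'; apply/eqP; rewrite -e -e' -addnA; congr (_ + _).
apply/anti_leq; rewrite gdist_triangle //=.
by have := gdist_triangle conn y r z; rewrite -e -e'; clear; lia.
Qed.

(** No geodesic to [q] passes to the right of the rail. Hence probes of the root
and of [q] identify a robber on the rail among all positions to the right of
it. *)
Lemma right_anc_rail q y : anc q y -> lt q y -> rail q y.
Proof.
elim/rail_ind: q => q IH hy qy.
have ne : y != q by apply/eqP => e; move: qy; rewrite e /lt ltnn.
have [z pz zy] := anc_pred hy ne.
have lq := parent_pos pz; have pg := par_parent lq; set g := par q in pg *.
have lzg : level z = level g by apply: succn_inj; rewrite (parent_level pz) (parent_level pg).
have lyq : level y < level q by rewrite -(parent_level pz) ltnS; exact: anc_level zy.
rewrite railE lq /= -/g; have [//|_ /=] := eqVneq y q.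
have [->|yg] := eqVneq y g; first exact: railxx.
have lyg : level y <= level g by rewrite -lzg; exact: anc_level zy.
have gy : lt g y.
  apply/negPn/negP => ngy; have qgP : path (@adj G) q [:: g] by rewrite /= (parent_adj pg).
  have [|z'] := path_under (u := y) qgP; first by rewrite /= qy (negbTE ngy).
  rewrite !inE => /orP[]/eqP-> anc_z.
    by have := anc_level anc_z; rewrite leqNgt lyq.
  by have e := anc_same_level anc_z lyg; rewrite e eqxx in yg.
apply: IH => //; rewrite -/g; have [<-//|zg] := eqVneq z g.
have qg : lt q g.
  apply/negPn/negP => ngq; have nqz : ~~ lt q z by apply: contra ngq; exact: par_greater.
  by have e := parent_side_uniq pz pg (etrans (negbTE nqz) (esym (negbTE ngq))); rewrite e eqxx in zg.
have zq : lt z q.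
  have zq : q != z by apply/eqP => e; have := parent_adj pz; rewrite e adj_irrefl.
  rewrite (lt_total zq); apply/negP => qz.
  by have e := parent_side_uniq pz pg (etrans qz (esym qg)); rewrite e eqxx in zg.
have [s [zs ey hs]] := geodesic conn z y.
have [|u] := path_under (u := g) zs.
  rewrite ey (ltn_trans zq qg : lt z g); have -> // : lt y g = false.
  by apply/negbTE; rewrite -leqNgt ltnW.
move=> /hs us gu; apply: anc_trans gu _; move: zy => /eqP e; apply/eqP/anti_leq.
rewrite gdist_triangle // andbT.
have := gdist_triangle conn u r z; move: e us.
rewrite (gdistC conn u z) (gdistC conn y u) (gdistC conn y z); clear; lia.
Qed.

(** * One step of the sweep *)

(** The right side of the rail to [p], with the rail, which can contain vertices
on either side of [p] in the order. *)
Definition right p x := (rank p <= rank x) || rail p x.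

Lemma edge_meets_rail p x y : adj x y -> lt y p -> lt p x -> rail p x || rail p y.
Proof.
move=> xy yp px; apply/negPn/negP; rewrite negb_or => /andP[nx ny].
have [s [ps e hs]] := rail_path p.
have xyP : path (@adj G) x [:: y] by rewrite /= xy.
have dis z : z \in [:: x; y] -> z \notin p :: s.
  by rewrite !inE => /orP[]/eqP->; [apply: contra nx|apply: contra ny]; exact: hs.
have := paths_dont_cross xyP ps dis; rewrite /= e.
have -> : lt x p = false by apply/negbTE; rewrite -leqNgt ltnW.
by rewrite yp /lt rank_r !ltn0.
Qed.

Lemma right_neighbor p x y : lt p x -> ~~ rail p x -> adj x y -> rail p y || lt p y.
Proof.
move=> px nx xy; have [//|pyr /=] := boolP (rail p y).
have py : p != y by apply: contraNneq pyr => <-; exact: railxx.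
apply/negPn/negP; rewrite -(lt_total py) => yp.
by have := edge_meets_rail xy yp px; rewrite (negbTE nx) (negbTE pyr).
Qed.

Lemma rail_parent p y w : rail p y -> parent y w -> lt p w -> rail p w.
Proof.
move=> py yw pw; apply: right_anc_rail pw; apply: anc_trans (rail_anc py) _.
apply: anc_step yw _; by rewrite /anc gdistxx // addn0.
Qed.

Lemma adj_levels x y : adj x y -> level y <= (level x).+1 /\ level x <= (level y).+1.
Proof. by move=> xy; split; apply: adj_gdist => //; rewrite adjC. Qed.

Section Step.
Variables p p' : G.
Hypothesis pp' : rank p' = (rank p).+1.

(** Where the robber can be, [j] steps from the root, once he is known to be
right of [p] and off the old rail. The last clause expresses the latter, as the
new rail contains all vertices of the old rail that are right of [p]. *)
Definition strip j x := [&& lt p x, level x == j & rail p' x ==> ~~ rail p x].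

Definition around (X : G -> Prop) y := exists2 x, X x & y = x \/ adj x y.

Lemma lt_right x : lt p x -> right p' x.
Proof. by rewrite /right /lt pp' => ->. Qed.

Lemma right_cases x : right p' x -> rail p' x || lt p' x.
Proof.
rewrite /right orbC => /orP[->//|h]; have [->|ne] := eqVneq x p'.
  by rewrite railxx.
apply/orP; right; rewrite /lt ltn_neqAle h andbT.
by apply/eqP => /rank_inj e; rewrite e eqxx in ne.
Qed.

Lemma beyond_neighbor x y : lt p' x -> ~~ rail p' x -> adj x y -> right p' y.
Proof.
move=> px nx xy; case/orP: (right_neighbor px nx xy) => h; rewrite /right ?h ?orbT //.
by rewrite ltnW.
Qed.

(** The new rail separates the vertices beyond it from the outside, so [x] is on
this rail; and the old rail separates [x] from the vertices left of it, so [y]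
is on the old rail. If [y] were one level above [x], then [x] would lie on a
geodesic to [p], hence on the old rail. *)
Lemma strip_escape j x y : strip j x -> adj x y -> ~~ right p' y ->
  [/\ rail p' x, ~~ rail p x, rail p y & (level y == j) || ((level y).+1 == j)].
Proof.
move=> /and3P[px /eqP lx imp] xy ny.
have rx : rail p' x.
  have := right_cases (lt_right px) => /orP[//|lx'].
  apply/negPn/negP => nr; by rewrite (beyond_neighbor lx' nr xy) in ny.
have nx : ~~ rail p x by move: imp; rewrite rx.
have py : rail p y.
  have := right_neighbor px nx xy => /orP[//|h]; by rewrite lt_right in ny.
split=> //; have [h1 h2] := adj_levels xy; rewrite lx in h1 h2.
have : level y != j.+1; last by move: h1 h2; clear; lia.
apply: contra nx => /eqP ly; apply: (rail_parent py) px.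
by rewrite /parent adjC xy lx ly eqxx.
Qed.

Lemma outside_neighbor y m : ~~ right p' y -> adj y m -> right p' m -> rail p' m.
Proof.
move=> ny ym rm; have [//|nm] := boolP (rail p' m).
have := right_cases rm; rewrite (negbTE nm) /= => pm.
by rewrite (beyond_neighbor pm nm) // adjC in ny.
Qed.

(** The three outcomes of a probe from which the sweep can go on: the position
is known, the next move keeps the robber on the right of [p'], or he has moved
up one level. *)
Definition resolved j (W : G -> Prop) :=
  [\/ forall w w', W w -> W w' -> w = w',
      forall y, around W y -> right p' y |
      forall w, W w -> strip j.+1 w].

Definition outcome j y w w' := [/\ around (strip j) w', level w' = level w & gdist y w' = gdist y w].

Lemma around_strip_level j w : around (strip j) w -> level w <= j.+1 /\ j <= (level w).+1.
Proof.
case=> x /and3P[_ /eqP lx _] [->|/adj_levels]; first by rewrite lx; split.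
by rewrite lx; case.
Qed.

Section FirstOutside.
Variables (j : nat) (x y : G).
Hypotheses (sx : strip j x) (xy : adj x y) (ny : ~~ right p' y).

Let px : lt p x. Proof. by case/and3P: sx. Qed.
Let lx : level x = j. Proof. by case/and3P: sx => _ /eqP. Qed.
Let rx : rail p' x. Proof. by have [] := strip_escape sx xy ny. Qed.
Let nx : ~~ rail p x. Proof. by have [] := strip_escape sx xy ny. Qed.
Let ry : rail p y. Proof. by have [] := strip_escape sx xy ny. Qed.

Lemma outside_around w : around (strip j) w -> ~~ right p' w ->
  [/\ adj x w, rail p w & (level w == j) || ((level w).+1 == j)].
Proof.
case=> x' sx' [->|x'w] nw; first by case/and3P: sx' => /lt_right h; rewrite h in nw.
have [rx' _ rw lw] := strip_escape sx' x'w nw; split=> //.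
suff -> : x = x' by [].
by apply: (rail_level rx rx'); case/and3P: sx' => _ /eqP-> _.
Qed.

Lemma higher_stays w : around (strip j) w -> level w = j.+1 -> strip j.+1 w.
Proof.
move=> aw lw; have rw : right p' w.
  apply/negPn/negP => nw; have [_ _] := outside_around aw nw.
  by rewrite lw; clear; lia.
rewrite /strip lw eqxx /=; have [rw'|nw] := boolP (rail p' w); last first.
  by have := right_cases rw; rewrite (negbTE nw) /= andbT /lt pp' => /ltnW.
have lw0 : 0 < level w by rewrite lw.
have pw := par_parent lw0.
have ex : par w = x.
  apply: (rail_level (rail_par rw' lw0) rx); rewrite lx.
  by apply: succn_inj; rewrite (parent_level pw).
rewrite ex in pw; have nw : ~~ rail p w.
  by apply: contra nx => h; rewrite -ex; exact: rail_par.
rewrite nw andbT; have xw : adj x w by rewrite adjC parent_adj.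
by have := right_neighbor px nx xw; rewrite (negbTE nw).
Qed.

Lemma rail'_lower w : rail p' w -> (level w).+1 = j -> w = par x /\ parent x w.
Proof.
move=> rw lw; have lx0 : 0 < level x by rewrite lx -lw.
have px' := par_parent lx0.
have e : w = par x.
  apply: (rail_level rw (rail_par rx lx0)); apply: succn_inj.
  by rewrite lw (parent_level px') lx.
by rewrite e; split.
Qed.

(** Such a parent would lie on a geodesic to [p'] that passes to the right of
its rail. *)
Lemma no_beyond_parent w : lt p' w -> ~~ rail p' w -> parent x w -> False.
Proof. by move=> h1 h2 h3; have := rail_parent rx h3 h1; rewrite (negbTE h2). Qed.

Lemma common_neighbor w : lt p' w -> ~~ rail p' w -> gdist y w = 2 ->
  exists m, [/\ adj y m, adj m w & rail p' m].
Proof.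
move=> h1 h2 /(gdist2 conn)[m ym mw]; exists m; split=> //.
apply: outside_neighbor ny ym _; apply: beyond_neighbor h1 h2 _.
by rewrite adjC.
Qed.

Lemma beyond_safe (W : G -> Prop) : (forall w, W w -> lt p' w /\ ~~ rail p' w) ->
  forall z, around W z -> right p' z.
Proof.
move=> h z [w /h [h1 h2] [->|]]; last exact: beyond_neighbor.
by rewrite /right ltnW.
Qed.

Lemma right_beyond w : right p' w -> ~~ rail p' w -> lt p' w.
Proof. by move=> /right_cases/orP[->|]. Qed.

(** At level [j], the distances 0 and 1 from [y] single out [y] and [x]. One
level below, distance 1 singles out the parent of [y] on the old rail; and at
distance 2 from [y], the only rival of the parent of [x] would be a further
parent of [x] beyond the new rail, which does not exist. *)
Lemma resolve_same_level : level y = j -> forall w, around (strip j) w ->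
  resolved j (outcome j y w).
Proof.
move=> ly w aw; have [aw1 aw2] := around_strip_level aw.
have dxy : gdist y x = 1 by apply: gdist_adj; rewrite adjC.
have [lw|lw] := eqVneq (level w) j.+1.
  by constructor 3 => w' [aw' e _]; apply: higher_stays; rewrite // e.
have [lwj|lwj] := eqVneq (level w) j.
  have out w' : outcome j y w w' -> ~~ right p' w' -> w' = y.
    move=> [aw' e _] nw'; have [_ rw' _] := outside_around aw' nw'.
    by apply: (rail_level rw' ry); rewrite e lwj ly.
  case: (ltngtP (gdist y w) 1) => d.
  - constructor 1 => w1 w2 [_ _ e1] [_ _ e2]; move: d; rewrite ltnS leqn0 => /eqP d.
    move: e1 e2; rewrite d => /eqP; rewrite gdist_eq0 => /eqP<- /eqP.
    by rewrite gdist_eq0 => /eqP.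
  - constructor 2; apply: beyond_safe => w' h; have [aw' e e'] := h.
    have rw' : right p' w'.
      apply/negPn/negP => nw'; move: d; rewrite -e' (out _ h nw') gdistxx //.
    have nw' : ~~ rail p' w'.
      apply/negP => rl; have ex := rail_level rl rx (etrans e (etrans lwj (esym lx))).
      by move: d; rewrite -e' ex dxy.
    by split=> //; exact: right_beyond.
  have isx w' : outcome j y w w' -> w' = x.
    move=> h; have [aw' e e'] := h; rewrite d in e'.
    have rw' : right p' w'.
      by apply/negPn/negP => nw'; move: e'; rewrite (out _ h nw') gdistxx.
    apply: (rail_level (outside_neighbor ny (gdist1 conn e') rw') rx).
    by rewrite e lwj lx.
  by constructor 1 => w1 w2 /isx-> /isx->.
have lw1 : (level w).+1 = j by move: aw1 aw2 lw lwj; clear; lia.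
have ly0 : 0 < level y by rewrite ly -lw1.
have low w' : outcome j y w w' -> rail p w' -> w' = par y.
  move=> [_ e _] rw'; apply: (rail_level rw' (rail_par ry ly0)).
  by apply: succn_inj; rewrite (parent_level (par_parent ly0)) e lw1.
have out w' : outcome j y w w' -> ~~ right p' w' -> gdist y w' = 1.
  move=> h nw'; have [aw' _ _] := h; have [_ rw' _] := outside_around aw' nw'.
  by rewrite (low _ h rw'); apply: gdist_adj; exact: parent_adj (par_parent ly0).
case: (ltngtP (gdist y w) 1) => d.
- constructor 1 => w1 w2 [_ _ e1] [_ _ e2]; move: d; rewrite ltnS leqn0 => /eqP d.
  move: e1 e2; rewrite d => /eqP; rewrite gdist_eq0 => /eqP<- /eqP.
  by rewrite gdist_eq0 => /eqP.
- have all_right w' : outcome j y w w' -> right p' w'.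
    move=> h; apply/negPn/negP => nw'; have [_ _ e'] := h.
    by move: d; rewrite -e' (out _ h nw').
  have [[w1 h1 r1]|none] := EM (exists2 w1, outcome j y w w1 & rail p' w1); last first.
    constructor 2; apply: beyond_safe => w' h; have rw' := all_right _ h.
    have nw' : ~~ rail p' w' by apply/negP => rl; apply: none; exists w'.
    by split=> //; exact: right_beyond.
  have [_ e1 d1] := h1; have lw1' : (level w1).+1 = j by rewrite e1.
  have [ew1 pw1] := rail'_lower r1 lw1'.
  have d2 : gdist y w = 2.
    apply/eqP; rewrite eqn_leq d andbT -d1.
    have := gdist_triangle conn x y w1; rewrite dxy.
    by rewrite (gdist_adj (parent_adj pw1)).
  suff isw1 w' : outcome j y w w' -> w' = w1.
    by constructor 1 => w2 w3 /isw1-> /isw1->.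
  move=> h; have [_ e' d'] := h; have [rl|nw'] := boolP (rail p' w').
    by apply: (rail_level rl r1); rewrite e'.
  have bw' := right_beyond (all_right _ h) nw'.
  rewrite d2 in d' d1; have [m [ym mw' rm]] := common_neighbor bw' nw' d'.
  have [m1 m2] := adj_levels ym; have [m3 m4] := adj_levels mw'.
  have [lm|lm] : level m = j \/ (level m).+1 = j.
    by move: m1 m2 m3 m4; rewrite e' ly -lw1; clear; lia.
    have em : m = x by apply: (rail_level rm rx); rewrite lm lx.
    exfalso; apply: (no_beyond_parent bw' nw').
    by rewrite /parent -em mw' e' lm lw1 eqxx.
  have em : m = w1 by apply: (rail_level rm r1); apply: succn_inj; rewrite lm lw1'.
  by move: d1; rewrite -em (gdist_adj ym).
have isl w' : outcome j y w w' -> w' = par y.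
  move=> h; apply: (low _ h); have [aw' e' d'] := h.
  rewrite d in d'; have yw' := gdist1 conn d'.
  have [rw'|nw'] := boolP (right p' w'); last by have [] := outside_around aw' nw'.
  have rl := outside_neighbor ny yw' rw'.
  have lw' : (level w').+1 = j by rewrite e'.
  have [_ pw'] := rail'_lower rl lw'.
  case/orP: (right_neighbor px nx (parent_adj pw')) => // pw.
  by apply: (rail_parent ry) pw; rewrite /parent yw' lw' ly eqxx.
by constructor 1 => w1 w2 /isl-> /isl->.
Qed.

(** As above, except that one level below [x], at distance 2 from [y], the
parent [w1] of [x] can have rivals, which are joined to [y] through a common
parent [m] of [y] and [w1]. The two rails then meet at [m], so that [w1] has no
neighbour outside and there is no need to tell it from its rivals. *)
Lemma resolve_lower_level : (level y).+1 = j ->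
  (forall y', adj x y' -> ~~ right p' y' -> level y' != j) ->
  forall w, around (strip j) w -> resolved j (outcome j y w).
Proof.
move=> ly low w aw; have [aw1 aw2] := around_strip_level aw.
have dxy : gdist y x = 1 by apply: gdist_adj; rewrite adjC.
have out w' : around (strip j) w' -> ~~ right p' w' -> w' = y.
  move=> aw' nw'; have [xw' rw' /orP[e|/eqP e]] := outside_around aw' nw'.
    by have := low _ xw' nw'; rewrite e.
  by apply: (rail_level rw' ry); apply: succn_inj; rewrite e ly.
have [lw|lw] := eqVneq (level w) j.+1.
  by constructor 3 => w' [aw' e _]; apply: higher_stays; rewrite // e.
have d0 : gdist y w = 0 -> resolved j (outcome j y w).
  move=> d; constructor 1 => w1 w2 [_ _ e1] [_ _ e2].
  move: e1 e2; rewrite d => /eqP; rewrite gdist_eq0 => /eqP<- /eqP.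
  by rewrite gdist_eq0 => /eqP.
have all_right w' : 0 < gdist y w -> outcome j y w w' -> right p' w'.
  move=> d [aw' _ e']; apply/negPn/negP => nw'.
  by move: d; rewrite -e' (out _ aw' nw') gdistxx.
have rail1 w' : gdist y w = 1 -> outcome j y w w' -> rail p' w'.
  move=> d h; have rw' := all_right _ (eq_leq (esym d)) h; have [_ _ e'] := h.
  by rewrite d in e'; apply: outside_neighbor ny (gdist1 conn e') rw'.
case: (ltngtP (gdist y w) 1) => d; first by apply: d0; move: d; clear; lia.
- have d' := ltnW d.
  have [[w1 h1 r1]|none] := EM (exists2 w1, outcome j y w w1 & rail p' w1); last first.
    constructor 2; apply: beyond_safe => w' h; have rw' := all_right _ d' h.
    have nw' : ~~ rail p' w' by apply/negP => rl; apply: none; exists w'.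
    by split=> //; exact: right_beyond.
  have [_ e1 d1] := h1; have [lwj|lwj] := eqVneq (level w) j.
    have ew1 : w1 = x by apply: (rail_level r1 rx); rewrite e1 lwj lx.
    by move: d; rewrite -d1 ew1 dxy.
  have lw1 : (level w).+1 = j by move: aw1 aw2 lw lwj; clear; lia.
  have lw1' : (level w1).+1 = j by rewrite e1.
  have [ew1 pw1] := rail'_lower r1 lw1'.
  have d2 : gdist y w = 2.
    apply/eqP; rewrite eqn_leq d andbT -d1.
    have := gdist_triangle conn x y w1; rewrite dxy.
    by rewrite (gdist_adj (parent_adj pw1)).
  have [[w2 h2 n2]|none] := EM (exists2 w2, outcome j y w w2 & ~~ rail p' w2); last first.
    constructor 1 => w2 w3 h2 h3.
    have isr w' : outcome j y w w' -> rail p' w'.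
      by move=> h; apply/negPn/negP => nw'; apply: none; exists w'.
    by apply: (rail_level (isr _ h2) (isr _ h3)); have [_ -> _] := h2; have [_ -> _] := h3.
  have b2 := right_beyond (all_right _ d' h2) n2.
  have [_ e2 dd2] := h2; rewrite d2 in dd2 d1.
  have [m [ym mw2 rm]] := common_neighbor b2 n2 dd2.
  have [m1 m2] := adj_levels ym; have [m3 m4] := adj_levels mw2.
  have lyw : level y = level w by apply: succn_inj; rewrite ly lw1.
  have lm : (level m).+1 = level y.
    have : level m != level y.
      apply/eqP => lm; have em : m = w1 by apply: (rail_level rm r1); rewrite lm e1.
      by move: d1; rewrite -em (gdist_adj ym).
    have : level m != j.
      apply/eqP => lm; have em : m = x by apply: (rail_level rm rx); rewrite lm lx.
      apply: (no_beyond_parent b2 n2).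
      by rewrite /parent -em mw2 e2 lm lw1 eqxx.
    by move: m1 m2; rewrite -ly; clear; lia.
  have nw1 : ~~ rail p w1.
    apply/negP => h; have e := rail_level h ry (etrans e1 (esym lyw)).
    by move: d1; rewrite e gdistxx.
  have pw1' : lt p w1.
    by have := right_neighbor px nx (parent_adj pw1); rewrite (negbTE nw1).
  have lm0 : 0 < level w1 by rewrite e1 -lyw -lm.
  have em : m = par w1.
    apply: (rail_level rm (rail_par r1 lm0)); apply: succn_inj.
    by rewrite (parent_level (par_parent lm0)) e1 lm lyw.
  have rmp : rail p m.
    have w1m : adj w1 m by rewrite em; exact: parent_adj (par_parent lm0).
    case/orP: (right_neighbor pw1' nw1 w1m) => // pm.
    by apply: (rail_parent ry) pm; rewrite /parent ym lm eqxx.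
  constructor 2 => u [w' h] uw'.
  have [rl|nw'] := boolP (rail p' w'); last first.
    apply: (beyond_safe (W := eq w')); last by exists w'.
    by move=> _ <-; split=> //; apply: right_beyond nw'; exact: all_right h.
  have ew' : w' = w1.
    by apply: (rail_level rl r1); have [_ -> _] := h; rewrite e1.
  subst w'; case: uw' => [->|w1u]; first by rewrite /right r1 orbT.
  apply/negPn/negP => nu; case/orP: (right_neighbor pw1' nw1 w1u) => ru; last first.
    by rewrite lt_right in nu.
  have [u1 u2] := adj_levels w1u; rewrite e1 -lyw in u1 u2.
  have [lu|[lu|lu]] : level u = (level y).+1 \/ level u = level y \/ (level u).+1 = level y by move: u1 u2; clear; lia.
  + move: nw1; rewrite (rail_parent ru _ pw1') //.
    by rewrite /parent adjC w1u lu e1 lyw eqxx.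
  + have eu := rail_level ru ry lu; subst u.
    by move: d1; rewrite gdistC // (gdist_adj w1u).
  have eu : u = m by apply: (rail_level ru rmp); apply: succn_inj; rewrite lu lm.
  by move: nu; rewrite eu /right rm orbT.
constructor 1 => w1 w2 h1 h2; apply: (rail_level (rail1 _ d h1) (rail1 _ d h2)).
by have [_ -> _] := h1; have [_ -> _] := h2.
Qed.
End FirstOutside.

(** A neighbour outside on the level of the robber takes precedence over one on
the level below. *)
Lemma strip_step j : (forall y, around (strip j) y -> right p' y) \/
  exists y, forall w, around (strip j) w -> resolved j (outcome j y w).
Proof.
have [[y [x sx xy] ny]|none] := EM (exists2 y, around (strip j) y & ~~ right p' y); last first.
  by left=> y ay; apply/negPn/negP => ny; apply: none; exists y.
case: xy => [e|xy]; first by case/and3P: sx => /lt_right h; rewrite e h in ny.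
right; have [[y' [xy' ny'] ly']|none] :=
    EM (exists2 y', adj x y' /\ ~~ right p' y' & level y' = j).
  by exists y'; exact: resolve_same_level sx xy' ny' ly'.
exists y; apply: (resolve_lower_level sx xy ny).
  have [_ _ _ /orP[/eqP e|/eqP //]] := strip_escape sx xy ny.
  by case: none; exists y.
by move=> y' xy' ny'; apply/eqP => e; apply: none; exists y'.
Qed.

End Step.

End Sweep.

(** * From sets of possible positions to a winning strategy *)

Section Knowledge.
Variables (G : sgraph) (m : nat).
Implicit Types (X Y : G -> Prop) (u : m.-tuple G).

Definition learn X u (d : m.-tuple nat) : G -> Prop :=
  fun y => exists w, [/\ X w, dist_vector u w = d & y = w \/ adj w y].

(** [n] probes suffice if the robber is known to be in [X]. The bound is uniform
in the outcomes of the probes, so that a strategy can follow it by counting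
rounds. *)
Fixpoint catch n X : Prop :=
  if n is n'.+1 then exists u, forall w w', X w -> X w' -> w' <> w ->
    dist_vector u w' = dist_vector u w -> catch n' (learn X u (dist_vector u w))
  else forall w, ~ X w.

Definition catchable X := exists n, catch n X.

Lemma catch_sub n X Y : (forall w, X w -> Y w) -> catch n Y -> catch n X.
Proof.
elim: n X Y => [|n IH] X Y XY /=; first by move=> h w /XY; exact: h.
move=> [u hu]; exists u => w w' Xw Xw' ne e.
apply: (IH _ (learn Y u (dist_vector u w))); last exact: hu (XY _ Xw) (XY _ Xw') ne e.
by move=> y [z [Xz ez h]]; exists z; split=> //; exact: XY.
Qed.

Lemma catchable_sub X Y : (forall w, X w -> Y w) -> catchable Y -> catchable X.
Proof. by move=> XY [n hn]; exists n; exact: catch_sub hn. Qed.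

Lemma catch_le (x0 : m.-tuple G) n n' X : n <= n' -> catch n X -> catch n' X.
Proof.
move=> /subnK <-; elim: (n' - n) => // k IH /IH {IH}.
rewrite addSn; elim: (k + n) X => [|j IH] X /=.
  by move=> h; exists x0 => w w' /h.
move=> [u hu]; exists u => w w' Xw Xw' ne e; apply: IH; exact: hu Xw Xw' ne e.
Qed.

Lemma catchable_probe X u :
  (forall w w', X w -> X w' -> w' <> w -> dist_vector u w' = dist_vector u w ->
     catchable (learn X u (dist_vector u w))) -> catchable X.
Proof.
move=> h.
have /choice[N hN] w : exists n,
    (exists w', [/\ X w, X w', w' <> w & dist_vector u w' = dist_vector u w]) ->
    catch n (learn X u (dist_vector u w)).
  have [[w' [Xw Xw' ne e]]|no] :=
      EM (exists w', [/\ X w, X w', w' <> w & dist_vector u w' = dist_vector u w]).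
    by have [n hn] := h w w' Xw Xw' ne e; exists n.
  by exists 0.
exists (\max_w N w).+1, u => w w' Xw Xw' ne e.
by apply: (catch_le u (leq_bigmax w)); apply: hN; exists w'.
Qed.

Definition knowledge (h : seq (m.-tuple G * m.-tuple nat)) : G -> Prop :=
  foldl (fun X ud => learn X ud.1 ud.2) (fun=> True) h.

Lemma history_size (S : strategy G m) r t : size (history S r t) = t.
Proof. by elim: t => //= t IH; rewrite size_rcons IH. Qed.

Lemma knowledge_sound (S : strategy G m) r r' t : trajectory t r' ->
  (forall s, s < t -> dist_vector (probe S r s) (r' s) = dist_vector (probe S r s) (r s)) ->
  knowledge (history S r t) (r' t).
Proof.
rewrite /knowledge; elim: t => // t IH tr e /=; rewrite foldl_rcons /=.
exists (r' t); split.
- by apply: IH => s st; [apply: tr|apply: e]; apply: leq_trans st _.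
- exact: e.
- exact: tr.
Qed.

(** The length of the history tells how many of the [N] rounds are left, which
selects the next probe. *)
Lemma catchable_cops_win : 0 < m -> catchable (fun=> True) -> cops_win G m.
Proof.
move=> m0 [N hN].
have [x0 _] : exists x0 : G, True by have := vertex_gt0 G => /card_gt0P[x _]; exists x.
pose good n X u := forall w w', X w -> X w' -> w' <> w ->
  dist_vector u w' = dist_vector u w -> catch n (learn X u (dist_vector u w)).
have /choice[best hbest] (nX : nat * (G -> Prop)) : exists u,
    catch nX.1.+1 nX.2 -> good nX.1 nX.2 u.
  case: nX => n X /=; have [[u hu]|no] := EM (catch n.+1 X); first by exists u.
  by exists [tuple x0 | i < m] => /no.
pose S h := best (N - (size h).+1, knowledge h).
exists S => r tr; apply: contrapT => none.
have inv t : t <= N -> catch (N - t) (knowledge (history S r t)).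
  elim: t => [|t IH] tN; first by rewrite subn0.
  have [r' [tr' e ne]] : exists r', [/\ trajectory t r',
      forall s, s <= t -> dist_vector (probe S r s) (r' s) = dist_vector (probe S r s) (r s)
      & r' t <> r t].
    apply: contrapT => no; apply: none; exists t => r' tr' e.
    by apply: contrapT => ne; apply: no; exists r'.
  have Nt : N - t = (N - t.+1).+1 by rewrite -subSn // subSS.
  have := IH (ltnW tN); rewrite Nt => /(hbest (_, _)) /= bestP.
  rewrite /knowledge /= foldl_rcons /= -/(knowledge _).
  have Sh : S (history S r t) = best (N - t.+1, knowledge (history S r t)).
    by rewrite /S history_size.
  rewrite Sh; apply: (bestP _ (r' t)).
  - exact: knowledge_sound (tr t) _.
  - by apply: knowledge_sound tr' _ => s /ltnW; exact: e.
  - exact: ne.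
  - by have := e t (leqnn t); rewrite /probe Sh.
have := inv N (leqnn N); rewrite subnn => /= empty.
by apply: (empty (r N)); exact: knowledge_sound (tr N) _.
Qed.

End Knowledge.

(** * The sweep wins *)

Section SweepGame.
Variable G : sgraph.
Hypothesis conn : graph_connected G.
Variable rank : G -> nat.
Hypothesis rank_inj : injective rank.
Hypothesis nc : forall a b c d, rank a < rank b -> rank b < rank c -> rank c < rank d ->
  adj a c -> ~~ adj b d.
Variable r : G.
Hypothesis rank_r : rank r = 0.
Hypothesis rank_onto : forall k, k < #|G| -> exists x, rank x = k.
Hypothesis rank_lt : forall x, rank x < #|G|.

Let probes y : 2.-tuple G := [tuple r; y].

Lemma probes_eq y w w' : dist_vector (probes y) w' = dist_vector (probes y) w ->
  gdist r w' = gdist r w /\ gdist y w' = gdist y w.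
Proof.
move=> e; split.
  by have := congr1 (fun v => tnth v ord0) e; rewrite !tnth_mktuple.
by have := congr1 (fun v => tnth v (Ordinal (isT : 1 < 2))) e; rewrite !tnth_mktuple.
Qed.

(** Only finitely many times can the robber answer by moving up one level. *)
Lemma catch_strip p p' j : rank p' = (rank p).+1 -> catchable 2 (right rank r p') ->
  catchable 2 (around (strip rank r p p' j)).
Proof.
move=> pp' cp'.
pose D := \max_x gdist r x.
have [n] := ubnP (D.+1 - j); elim: n j => // n IH j jn.
have [safe|[y hy]] := strip_step conn rank_inj nc rank_r pp' j.
  by apply: catchable_sub cp' => w; exact: safe.
apply: (catchable_probe (u := probes y)) => w w' aw aw' ne e.
have sub v : learn (around (strip rank r p p' j)) (probes y) (dist_vector (probes y) w) v ->
    around (outcome rank r p p' j y w) v.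
  by move=> [z [az /probes_eq[e1 e2] h]]; exists z.
case: (hy w aw) => [uniq|safe|up].
- by case: ne; apply: uniq; split=> //; case: (probes_eq e).
- by apply: catchable_sub cp' => v /sub; exact: safe.
apply: (@catchable_sub _ _ _ (around (strip rank r p p' j.+1))).
  by move=> v /sub[z /up sz h]; exists z.
apply: IH; have jD : j <= D.
  by case: aw => x /and3P[_ /eqP <- _] _; exact: (leq_bigmax x).
by move: jn jD; clear; lia.
Qed.

(** A probe of [p] catches a robber on the rail to [p], and otherwise leaves a
strip between this rail and the one to the next vertex. *)
Lemma catch_right p : catchable 2 (right rank r p).
Proof.
have [n] := ubnP (#|G| - rank p); elim: n p => // n IH p pn.
apply: (catchable_probe (u := probes p)) => w w' rw rw' ne /probes_eq[e1 e2].
have on_rail v v' : right rank r p v' -> gdist r v' = gdist r v ->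
    gdist p v' = gdist p v -> rail rank r p v -> v' = v.
  move=> rv' f1 f2 rv; apply: (rail_level conn _ rv f1).
  have av' : anc r p v'.
    by rewrite /anc f1 (gdistC conn v' p) f2 (gdistC conn p v); exact: (rail_anc conn rv).
  case/orP: rv' => //; rewrite leq_eqVlt => /orP[/eqP/rank_inj<-|]; first exact: railxx.
  exact: (right_anc_rail conn rank_inj nc rank_r av').
have off v : right rank r p v -> gdist r v = gdist r w -> gdist p v = gdist p w ->
    ~~ rail rank r p v /\ rank p < rank v.
  move=> rv f1 f2; have nv : ~~ rail rank r p v.
    apply/negP => h; apply: ne.
    have -> := on_rail v w' rw' (etrans e1 (esym f1)) (etrans e2 (esym f2)) h.
    by have -> := on_rail v w rw (esym f1) (esym f2) h.
  split=> //; case/orP: rv => [|h]; last by rewrite h in nv.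
  rewrite leq_eqVlt => /orP[/eqP/rank_inj e|//].
  by move: nv; rewrite -e railxx.
have [_ pw] := off w rw erefl erefl.
have [p' pp'] := rank_onto (leq_ltn_trans pw (rank_lt w)).
apply: (@catchable_sub _ _ _ (around (strip rank r p p' (gdist r w)))).
  move=> v [z [rz /probes_eq[f1 f2] h]]; exists z => //.
  by have [nz pz] := off z rz f1 f2; rewrite /strip pz f1 eqxx nz implybT.
apply: (catch_strip _ pp'); apply: IH; rewrite pp'.
by move: (rank_lt p) pn; clear; lia.
Qed.

Lemma noncrossing_cops_win : cops_win G 2.
Proof.
apply: catchable_cops_win => //.
apply: (@catchable_sub _ _ _ (right rank r r)); last exact: catch_right.
by move=> w _; rewrite /right rank_r.
Qed.

End SweepGame.

Theorem theorem3p1 (R : realType) (G : sgraph) :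
  graph_connected G -> outerplanar R G -> localization_number G <= 2.
Proof.
move=> conn [pos [arc [dr outer]]].
have [w [q [e [Q [E pd]]]]] := exists_polygonal_drawing dr outer.
have [s [us sG nc]] :=
  noncrossing_order (polygonal_theta_free pd) (polygonal_K4_free pd) [set: G].
have s_all x : x \in s by rewrite sG inE.
have s_size : size s = #|G| by rewrite -(card_uniqP us); apply: eq_card => x; rewrite s_all.
have index_lt x : index x s < #|G| by rewrite -s_size index_mem.
have index_onto k : k < #|G| -> exists x, index x s = k.
  rewrite -s_size => ks; have [x0 _] : exists x0 : G, True by case: (s) ks => // x0 *; exists x0.
  by exists (nth x0 s k); rewrite index_uniq.
have index_inj : injective (index^~ s).
  by move=> x y /= h; rewrite -(nth_index x (s_all x)) h nth_index.
have [r index_r] := index_onto 0 (vertex_gt0 G).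
have win : cops_win G 2.
  apply: (noncrossing_cops_win conn index_inj _ index_r index_onto index_lt).
  by move=> a b c d ab bc cd; apply: nc ab bc cd _; rewrite index_mem.
rewrite /localization_number; case: ex_minnP => m _ /(_ 2); apply.
by apply/andP; split=> //; apply/asboolP.
Qed.
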